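(* Assume the Böttcher case ($p_0=p_1=0$), that $\mathbf{E}e^{h|X_1|}<\infty$ for some $h>0$, and that $\varepsilon_n>0$ with $\varepsilon_n\to0$ and $\varepsilon_n^2m^n\to\infty$. Then \[ \mu\log\mathsf B\big(\varphi(1/(2\sigma^2))\big)\le\liminf_{n\to\infty}\varepsilon_n^{-2\beta}m^{-\beta n}\log\mathbf{P}(R_n\ge\varepsilon_n)\le\limsup_{n\to\infty}\varepsilon_n^{-2\beta}m^{-\beta n}\log\mathbf{P}(R_n\ge\varepsilon_n)\le\mu^{-1}\log\mathsf B\big(\varphi(1/(2\sigma^2))\big). \] If additionally $\varepsilon_n=m^{-\lambda_n/2}$ for integers $\lambda_n\to\infty$ with $\lambda_n=o(n)$, then \[\lim_{n\to\infty}\varepsilon_n^{-2\beta}m^{-\beta n}\log\mathbf{P}(R_n\ge\varepsilon_n)=\log\mathsf B\big(\varphi(1/(2\sigma^2))\big).\]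
   Context: Standing setup: $Z=(Z_n)_{n\ge0}$ is a Galton–Watson process with $Z_0=1$ and offspring law $\{p_k\}$ with mean $m\in(1,\infty)$ and $\mathbf{E}Z_1\log Z_1<\infty$. Independently, $(X_n)$ are i.i.d. with $\mathbf{E}X_1=0$, $\sigma^2:=\mathbf{E}X_1^2\in(0,\infty)$; $S_k:=X_1+\dots+X_k$; $R_n:=S_{Z_n}/Z_n$ on $\{Z_n>0\}$, and $\mathbf{P}(R_n\ge x)$ means $\mathbf{P}(R_n\ge x, Z_n>0)$. Böttcher case: $p_0+p_1=0$; then $\mu:=\min\{k:p_k>0\}\ge2$ and the Böttcher constant $\beta\in(0,1)$ is defined by $\mu=m^\beta$. $f$ is the offspring generating function, $f_n$ its $n$-th iterate, and $\mathsf B(s):=\lim_{n\to\infty}(f_n(s))^{\mu^{-n}}$, $0\le s\le1$ (this limit exists, is positive and continuous). $W:=\lim_nm^{-n}Z_n$ a.s. and $\varphi(h):=\mathbf{E}e^{-hW}$. *)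

(* Defs.v *)
From HB Require Import structures.
From mathcomp Require Import all_boot all_order all_algebra.
From mathcomp Require Import all_classical all_reals all_analysis.
Set Implicit Arguments. Unset Strict Implicit. Unset Printing Implicit Defensive.
Import Order.TTheory GRing.Theory Num.Theory.
Import numFieldNormedType.Exports.
Local Open Scope classical_set_scope.
Local Open Scope ring_scope.

Definition mutually_independent {d} {T : measurableType d} {R : realType}
  (P : probability T R) {I : eqType} (Y : I -> T -> R) : Prop :=
  forall (s : seq I) (A : I -> set R), uniq s -> (forall i, measurable (A i)) ->
    P (\bigcap_(i in [set` s]) (Y i @^-1` A i)) =
    (\prod_(i <- s) P (Y i @^-1` A i))%E.

(* Galton-Watson process built from the offspring variables xi n i
   (number of children of the i-th individual of generation n), Z_0 = 1. *)
Fixpoint GW {T : Type} (xi : nat -> nat -> T -> nat) (n : nat) (t : T) : nat :=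
  match n with
  | 0 => 1
  | n'.+1 => \sum_(i < GW xi n' t) xi n' i t
  end.

(* Partial sums S_k = X_0 + ... + X_(k-1) (the paper's X_1 + ... + X_k). *)
Definition Ssum {R : realType} {T : Type} (X : nat -> T -> R) (k : nat) (t : T) : R :=
  \sum_(i < k) X i t.

Definition Rn {R : realType} {T : Type} (xi : nat -> nat -> T -> nat)
  (X : nat -> T -> R) (n : nat) (t : T) : R :=
  Ssum X (GW xi n t) t / (GW xi n t)%:R.

Definition pgf {R : realType} (p : nat -> R) (s : R) : R :=
  limn (series (fun k => p k * s ^+ k)).

Definition pgf_iter {R : realType} (p : nat -> R) (n : nat) (s : R) : R :=
  iter n (pgf p) s.

Definition Boettcher {R : realType} (p : nat -> R) (mu : nat) (s : R) : R :=
  limn (fun n => pgf_iter p n s `^ ((mu%:R ^+ n)^-1)).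

(* W = lim_n m^-n Z_n (pointwise limit; it exists a.s.). *)
Definition Wlim {R : realType} {T : Type} (xi : nat -> nat -> T -> nat) (m : R)
  (t : T) : R :=
  limn (fun n => (GW xi n t)%:R / m ^+ n).

Definition phiW {d} {T : measurableType d} {R : realType} (P : probability T R)
  (xi : nat -> nat -> T -> nat) (m : R) (h : R) : R :=
  fine (\int[P]_t (expR (- h * Wlim xi m t))%:E)%E.

Definition variance0 {d} {T : measurableType d} {R : realType} (P : probability T R)
  (X : T -> R) : R :=
  fine (\int[P]_t ((X t) ^+ 2)%:E)%E.

Definition probRn {d} {T : measurableType d} {R : realType} (P : probability T R)
  (xi : nat -> nat -> T -> nat) (X : nat -> T -> R) (n : nat) (x : R) : R :=
  fine (P [set t | (0 < GW xi n t)%N /\ x <= Rn xi X n t]).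

Definition normlogP {d} {T : measurableType d} {R : realType} (P : probability T R)
  (xi : nat -> nat -> T -> nat) (X : nat -> T -> R) (m beta : R) (eps : nat -> R)
  (n : nat) : R :=
  eps n `^ (- (2 * beta)) * m `^ (- (beta * n%:R)) * ln (probRn P xi X n (eps n)).

(* Main.v *)
(** Conditioning on [Z_n] gives [P(R_n >= eps) = \sum_k P(Z_n = k) P(S_k >= eps k)].
    Chernoff bounds that are uniform in [k] place this probability, up to a
    constant factor, between the values of [f_n] at
    [exp(- (1 + delta) a eps^2)] and [exp(- (1 - delta) a eps^2)], where
    [a = 1 / (2 sigma^2)]; Jensen's inequality [f_n(s^c) >= f_n(s)^c] for [c >= 1]
    then turns [delta] into a factor in front of [log f_n(exp(- a eps^2))].
    Choose [l] with [m^l] comparable to [eps^-2] and write [f_n = f_(n-l) o f_l].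
    The inner value [f_l(exp(- a m^-l)) = E exp(- a Z_l / m^l)] tends to [phi(a)]
    because the martingale [Z_l / m^l] converges a.s. (upcrossing inequality), and
    [log f_N(s) / mu^N] decreases to [log B(s)], uniformly in [s], since
    [p_mu s^mu <= f(s) <= s^mu].  For general [eps] the product [eps^2 m^l] is only
    known up to a factor [m], which costs the factors [mu] and [mu^-1]. *)

Require Import Defs.
From HB Require Import structures.
From mathcomp Require Import all_boot all_order all_algebra.
From mathcomp Require Import all_classical all_reals all_analysis.
From mathcomp Require Import measurable_realfun ring lra.
Set Implicit Arguments.
Unset Strict Implicit.
Unset Printing Implicit Defensive.
Import Order.TTheory GRing.Theory Num.Theory.
Import numFieldNormedType.Exports.
Local Open Scope classical_set_scope.
Local Open Scope ring_scope.

(** * Generating functions *)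

(** The obstacle is the lower bound. The variable [Z_n] may be as small as [mu^n], and for such [k]
    the product [k eps^2] can be small, so that a tilted sum does not concentrate at the scale of
    [eps]. There the event is shrunk: the deviation is enlarged to [e'] with [k e'^2] equal to a
    fixed constant. This costs only a constant factor, harmless because its logarithm is divided by
    [mu^(n-l)] with [n - l -> oo]. Since [e'] must still be small enough for the expansion of the
    moment generating function, [k] has to be large, and this comes from [Z_n >= mu^n > n] almost
    surely.

    Errors in the exponent are kept relative, never additive: [log f_n] is of order [mu^(n-l)], and
    only a relative error survives Jensen's inequality uniformly in [n].

    Conditioning is done without conditional expectations. The trajectory up to time [n] is coded by
    a natural number, and integrals are compared on each fibre of the code, where [Z_n] is constant
    and the remaining variables are independent of the fibre. *)

Section pgf.
Context {R : realType}.
Variables (p : nat -> R) (m : R) (mu : nat).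
Hypotheses (p_ge0 : forall k, 0 <= p k) (p_sum : series p @ \oo --> (1 : R)).
Hypothesis p_mean : series (fun k => k%:R * p k) @ \oo --> m.
Hypotheses (p0 : p 0%N = 0) (p1 : p 1%N = 0).
Hypotheses (p_mu : 0 < p mu) (p_lt_mu : forall k, (k < mu)%N -> p k = 0).

Lemma mu_ge2 : (2 <= mu)%N.
Proof. by case: mu p_mu => [|[|]]//; rewrite ?p0 ?p1 ltxx. Qed.

Lemma cvg_pgf (s : R) : 0 <= s <= 1 ->
  series (fun k => p k * s ^+ k) @ \oo --> pgf p s.
Proof.
move=> /andP[s0 s1]; apply: (@series_le_cvg _ _ p).
- by move=> k; rewrite mulr_ge0// exprn_ge0.
- by [].
- by move=> k; rewrite ler_piMr// exprn_ile1.
- by apply/cvg_ex; exists 1.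
Qed.

Lemma le_cvg_series (u v : nat -> R) (a b : R) : (forall k, u k <= v k) ->
  series u @ \oo --> a -> series v @ \oo --> b -> a <= b.
Proof.
move=> uv ua vb; rewrite -(cvg_lim (@Rhausdorff R) ua) -(cvg_lim (@Rhausdorff R) vb).
by apply: lim_series_le => //; apply/cvg_ex; eexists; [exact: ua|exact: vb].
Qed.

Lemma cvg_seriesZ (u : nat -> R) (a c : R) : series u @ \oo --> a ->
  series (fun k => u k * c) @ \oo --> a * c.
Proof.
move=> ua; rewrite (_ : series _ = (fun n => series u n * c)); first exact: cvgMr_tmp.
by apply/funext => n; rewrite /series /= mulr_suml.
Qed.

Lemma pgf_le_pow s : 0 <= s <= 1 -> pgf p s <= s ^+ mu.
Proof.
move=> s01; rewrite -[leRHS]mul1r; apply: (le_cvg_series _ (cvg_pgf s01) (cvg_seriesZ p_sum)).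
move=> k; have [/p_lt_mu ->|muk] := ltnP k mu; first by rewrite !mul0r.
by case/andP: s01 => *; rewrite ler_wpM2l// ler_wiXn2l.
Qed.

Lemma pgf_ge_pow s : 0 <= s <= 1 -> p mu * s ^+ mu <= pgf p s.
Proof.
move=> s01; have s0 : 0 <= s by case/andP: s01.
have h := cvg_pgf s01; rewrite -(cvg_lim (@Rhausdorff R) h).
apply: limr_ge; first by apply/cvg_ex; eexists; exact: h.
exists mu.+1 => // n /= mun; rewrite /series /= (bigD1_seq mu) ?iota_uniq ?mem_index_iota//=.
by rewrite lerDl sumr_ge0// => k _; rewrite mulr_ge0// exprn_ge0.
Qed.

Lemma pgf_itv s : 0 < s <= 1 -> 0 < pgf p s <= 1.
Proof.
move=> /andP[s0 s1]; have s01 : 0 <= s <= 1 by rewrite ltW.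
rewrite (lt_le_trans _ (pgf_ge_pow s01)) ?mulr_gt0 ?exprn_gt0//=.
by rewrite (le_trans (pgf_le_pow s01))// exprn_ile1// ltW.
Qed.

Lemma pgf_le s t : 0 <= s -> s <= t -> t <= 1 -> pgf p s <= pgf p t.
Proof.
move=> s0 st t1; apply: (le_cvg_series _ (cvg_pgf _) (cvg_pgf _)).
- by move=> k; rewrite ler_wpM2l// lerXn2r// nnegrE// (le_trans s0).
- by rewrite s0 (le_trans st).
- by rewrite t1 (le_trans s0).
Qed.

(** Termwise [t^k <= s^k + k (t - s)] on [[0, 1]], by induction on [k], then summed against [p].
    This supplies the continuity of [f] up to the endpoint [1]. *)
Lemma pgf_lipschitz s t : 0 <= s -> s <= t -> t <= 1 -> pgf p t <= pgf p s + m * (t - s).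
Proof.
move=> s0 st t1.
have cs := cvg_pgf (s := s); have ct := cvg_pgf (s := t).
rewrite s0 (le_trans st t1) in cs; rewrite t1 (le_trans s0 st) in ct.
apply: (le_cvg_series _ (ct erefl)
  (v := fun k => p k * s ^+ k + k%:R * p k * (t - s))); last first.
  have -> : series (fun k => p k * s ^+ k + k%:R * p k * (t - s)) =
     (fun n => series (fun k => p k * s ^+ k) n + series (fun k => k%:R * p k * (t - s)) n).
    by apply/funext => n; rewrite /series /= big_split.
  by apply: cvgD; [exact: cs|exact: cvg_seriesZ].
move=> k; rewrite [k%:R * p k]mulrC -mulrA -mulrDr ler_wpM2l//.
elim: k => [|k ih]; first by rewrite !expr0 mul0r addr0.
rewrite exprS (le_trans (ler_wpM2l (le_trans s0 st) ih))// exprS.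
have sk : s ^+ k <= 1 by rewrite exprn_ile1// (le_trans st).
have sk0 : 0 <= s ^+ k by rewrite exprn_ge0.
have : 0 <= k%:R * (t - s) by rewrite mulr_ge0// subr_ge0.
rewrite -natr1; nra.
Qed.

Lemma pgf_iterS n s : pgf_iter p n.+1 s = pgf p (pgf_iter p n s).
Proof. by []. Qed.

Lemma pgf_iter_itv n s : 0 < s <= 1 -> 0 < pgf_iter p n s <= 1.
Proof. by move=> s01; elim: n => // n ih; exact: pgf_itv. Qed.

Lemma pgf_iter_le n s t : 0 < s -> s <= t -> t <= 1 -> pgf_iter p n s <= pgf_iter p n t.
Proof.
move=> s0 st t1; have s1 := le_trans st t1; have t0 := lt_le_trans s0 st.
elim: n => // n ih; rewrite !pgf_iterS pgf_le//.
  by have /andP[/ltW] := pgf_iter_itv n (s := s) (introT andP (conj s0 s1)).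
by have /andP[] := pgf_iter_itv n (s := t) (introT andP (conj t0 t1)).
Qed.

Lemma pgf_iter_le_pow n s : 0 < s <= 1 -> pgf_iter p n s <= s ^+ (mu ^ n).
Proof.
move=> s01; elim: n => [|n ih]; first by rewrite expn0 expr1.
have /andP[f0 f1] := pgf_iter_itv n s01.
rewrite pgf_iterS (le_trans (pgf_le_pow _)) ?(ltW f0)//.
rewrite expnSr exprM lerXn2r// nnegrE ?(ltW f0)// exprn_ge0// ltW//.
by case/andP: s01.
Qed.

(** Jensen's inequality: [exp(- k u)] is bounded below by the tangent of [exp(- y)] at the mean
    [y = m u], and the sum over [k] of the linear terms vanishes. Iterated, it keeps [phi] away from
    [0]. *)
Lemma pgf_expR_ge u : 0 <= u -> expR (- (m * u)) <= pgf p (expR (- u)).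
Proof.
move=> u0; have s01 : 0 <= expR (- u) <= 1 by rewrite expR_ge0 expR_le1 oppr_le0.
have h : series (fun k => p k * (expR (- (m * u)) * (1 + m * u)) +
    k%:R * p k * (- (expR (- (m * u)) * u))) @ \oo --> expR (- (m * u)).
  have -> : series (fun k => p k * (expR (- (m * u)) * (1 + m * u)) +
      k%:R * p k * (- (expR (- (m * u)) * u))) =
    (fun n => series (fun k => p k * (expR (- (m * u)) * (1 + m * u))) n +
      series (fun k => k%:R * p k * (- (expR (- (m * u)) * u))) n).
    by apply/funext => n; rewrite /series /= big_split.
  rewrite [X in _ --> X](_ : _ = 1 * (expR (- (m * u)) * (1 + m * u)) +
    m * (- (expR (- (m * u)) * u))); last by ring.
  by apply: cvgD; exact: cvg_seriesZ.
apply: (le_cvg_series _ h (cvg_pgf s01)) => k.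
rewrite [k%:R * _]mulrC -mulrA -mulrDr ler_wpM2l// -expRM_natl.
have -> : k%:R * - u = - (m * u) + (m * u - k%:R * u) by ring.
rewrite expRD; have := expR_ge1Dx (m * u - k%:R * u); have := expR_gt0 (- (m * u)).
nra.
Qed.

Lemma pgf_iter_expR_ge n u : 0 <= u -> 0 <= m ->
  expR (- (m ^+ n * u)) <= pgf_iter p n (expR (- u)).
Proof.
move=> u0 m0; elim: n => [|n ih]; first by rewrite expr0 mul1r.
have v0 : 0 <= m ^+ n * u by rewrite mulr_ge0// exprn_ge0.
rewrite pgf_iterS exprS -mulrA (le_trans (pgf_expR_ge v0))// pgf_le ?expR_ge0//.
have s01 : 0 < expR (- u) <= 1 by rewrite expR_gt0 expR_le1 oppr_le0.
by have /andP[] := pgf_iter_itv n s01.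
Qed.

(** Bernoulli's inequality [y^c >= 1 + c (y - 1)] at [y = e^w], from [e^((c-1) w) >= 1 + (c-1) w]
    and [(1 - w) e^w <= 1]. *)
Let expR_bernoulli (c w : R) : 1 <= c -> 1 + c * (expR w - 1) <= expR (c * w).
Proof.
move=> c1; have -> : c * w = w + (c - 1) * w by ring.
rewrite expRD; have := expR_ge1Dx ((c - 1) * w); have w0 := expR_gt0 w.
have : (1 - w) * expR w <= 1.
  have := ler_wpM2r (ltW w0) (expR_ge1Dx (- w)).
  by rewrite -expRD addNr expR0.
move=> h1 /(ler_wpM2l (ltW w0)); apply: le_trans.
have c10 : 0 <= c - 1 by rewrite subr_ge0.
by have := ler_wpM2l c10 h1; lra.
Qed.

(* Jensen's inequality for y |-> y ^ c, with E s^Z = pgf p s. *)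
Lemma ln_pgf_scale c x : 1 <= c -> x <= 0 ->
  c * ln (pgf p (expR x)) <= ln (pgf p (expR (c * x))).
Proof.
move=> c1 x0; have cx0 : c * x <= 0 by rewrite mulr_ge0_le0// (le_trans ler01).
have y01 : 0 < expR x <= 1 by rewrite expR_gt0 expR_le1.
have z01 : 0 < expR (c * x) <= 1 by rewrite expR_gt0 expR_le1.
have /andP[f0 f1] := pgf_itv y01; have /andP[g0 g1] := pgf_itv z01.
rewrite -ler_expR [leRHS]lnK ?posrE//; set b := ln (pgf p (expR x)).
have fb : pgf p (expR x) = expR b by rewrite lnK ?posrE.
have y01' : 0 <= expR x <= 1 by rewrite expR_ge0 expR_le1.
have z01' : 0 <= expR (c * x) <= 1 by rewrite expR_ge0 expR_le1.
(* The summand is [p k] times the tangent of [y^c] at [y = e^b = f(e^x)], evaluated at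
   [y = e^(k x)]. As the point of tangency is the mean, the total is exactly [e^(c b)]. *)
have h : series (fun k => p k * (expR (c * b) * (1 - c)) +
    p k * expR x ^+ k * (expR (c * b) * c * expR (- b))) @ \oo --> expR (c * b).
  have -> : series (fun k => p k * (expR (c * b) * (1 - c)) +
      p k * expR x ^+ k * (expR (c * b) * c * expR (- b))) =
    (fun n => series (fun k => p k * (expR (c * b) * (1 - c))) n +
      series (fun k => p k * expR x ^+ k * (expR (c * b) * c * expR (- b))) n).
    by apply/funext => n; rewrite /series /= big_split.
  rewrite [X in _ --> X](_ : _ = 1 * (expR (c * b) * (1 - c)) +
    pgf p (expR x) * (expR (c * b) * c * expR (- b))); last first.
    by rewrite fb expRN; field; rewrite gt_eqF ?expR_gt0.
  by apply: cvgD; apply: cvg_seriesZ => //; exact: cvg_pgf.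
apply: (le_cvg_series _ h (cvg_pgf z01')) => k.
rewrite -mulrA -mulrDr ler_wpM2l// -!expRM_natl.
have := expR_bernoulli (k%:R * x - b) c1.
move=> /(ler_wpM2l (expR_ge0 (c * b))); rewrite -expRD.
rewrite (_ : c * b + c * (k%:R * x - b) = k%:R * (c * x)); last by ring.
by apply: le_trans; rewrite expRD; lra.
Qed.

Lemma ln_pgf_iter_scale n c x : 1 <= c -> x <= 0 ->
  c * ln (pgf_iter p n (expR x)) <= ln (pgf_iter p n (expR (c * x))).
Proof.
move=> c1 x0; have cx0 : c * x <= 0 by rewrite mulr_ge0_le0// (le_trans ler01).
elim: n => [|n ih]; first by rewrite /pgf_iter /= !expRK.
have y01 : 0 < expR x <= 1 by rewrite expR_gt0 expR_le1.
have z01 : 0 < expR (c * x) <= 1 by rewrite expR_gt0 expR_le1.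
have /andP[f0 f1] := pgf_iter_itv n y01; have /andP[g0 g1] := pgf_iter_itv n z01.
have l0 : ln (pgf_iter p n (expR x)) <= 0 by exact: ln_le0.
(* With [f_n(e^x) = e^y] and [y <= 0], the one-step inequality applies to the outer [f];
   monotonicity of [f] then absorbs the induction hypothesis. *)
rewrite !pgf_iterS -[pgf_iter p n (expR x)]lnK ?posrE//.
rewrite (le_trans (ln_pgf_scale c1 l0))//.
have eg : expR (c * ln (pgf_iter p n (expR x))) <= pgf_iter p n (expR (c * x)).
  by rewrite -[leRHS]lnK ?posrE// ler_expR.
rewrite ler_ln ?posrE ?pgf_le ?expR_ge0//.
  have /pgf_itv/andP[]// : 0 < expR (c * ln (pgf_iter p n (expR x))) <= 1.
  by rewrite expR_gt0 (le_trans eg).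
by have /pgf_itv/andP[] := pgf_iter_itv n z01.
Qed.

Lemma cvg_pgf_iter n (x : nat -> R) (l : R) : (forall k, 0 < x k <= 1) -> 0 < l <= 1 ->
  x @ \oo --> l -> (fun k => pgf_iter p n (x k)) @ \oo --> pgf_iter p n l.
Proof.
move=> x01 l01 xl; elim: n => // n ih.
have pgfB a b : 0 < a <= 1 -> 0 < b <= 1 -> `|pgf p a - pgf p b| <= m * `|a - b|.
  have le_ab u v : 0 < u -> v <= 1 -> u <= v -> `|pgf p u - pgf p v| <= m * `|u - v|.
    move=> u0 v1 uv; rewrite distrC [`|u - v|]distrC !ger0_norm ?subr_ge0// ?pgf_le ?(ltW u0)//.
    by rewrite lerBlDl pgf_lipschitz// ltW.
  move=> /andP[a0 a1] /andP[b0 b1]; have [ab|/ltW ba] := leP a b; first exact: le_ab.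
  by rewrite distrC [`|a - b|]distrC le_ab.
apply/subr_cvg0/norm_cvg0P.
have : (fun k => m * `|pgf_iter p n (x k) - pgf_iter p n l|) @ \oo --> (0 : R).
  rewrite -[X in _ --> X](mulr0 m); apply: cvgMl_tmp.
  by apply/norm_cvg0P/subr_cvg0.
apply: squeeze_cvgr; last exact: cvg_cst.
by apply: nearW => k; rewrite normr_ge0 /= pgfB// pgf_iter_itv.
Qed.

Definition logpgf (n : nat) (s : R) : R := ln (pgf_iter p n s) / mu%:R ^+ n.

Let mu_gt0 : 0 < mu%:R :> R.
Proof. by rewrite ltr0n (leq_trans _ mu_ge2). Qed.

Lemma logpgf_le0 n s : 0 < s <= 1 -> logpgf n s <= 0.
Proof.
move=> s01; have /andP[f0 f1] := pgf_iter_itv n s01.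
by rewrite /logpgf mulr_le0_ge0 ?invr_ge0 ?exprn_ge0 ?ln_le0// ltW.
Qed.

Lemma nonincreasing_logpgf s : 0 < s <= 1 -> nonincreasing_seq (fun n => logpgf n s).
Proof.
move=> s01; apply/nonincreasing_seqP => n; have f01 := pgf_iter_itv n s01.
have /andP[f0 f1] := f01; have /andP[g0 g1] := pgf_itv f01.
rewrite /logpgf /= exprS invfM mulrA ler_pM2r ?invr_gt0 ?exprn_gt0//=.
rewrite ler_pdivrMr// mulr_natr -lnXn// ler_ln ?posrE ?exprn_gt0//.
by rewrite pgf_le_pow// f1 ltW.
Qed.

Let err n : R := - ln (p mu) / mu%:R ^+ n.

Let err_ge0 n : 0 <= err n.
Proof.
rewrite /err mulNr oppr_ge0 mulr_le0_ge0 ?invr_ge0 ?exprn_ge0 ?(ltW mu_gt0)//.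
apply: ln_le0; have := @pgf_ge_pow 1; rewrite ler01 lexx expr1n mulr1 => /(_ erefl)/le_trans; apply.
by have := @pgf_le_pow 1; rewrite ler01 lexx expr1n => /(_ erefl).
Qed.

(** By [p_mu s^mu <= f(s)], passing from [n] to [n + 1] loses at most [- ln p_mu / mu^(n+1)]. The
    added term compensates for it because [mu ln p_mu <= 2 ln p_mu], which is where [mu >= 2]
    enters. *)
Lemma nondecreasing_logpgf s : 0 < s <= 1 ->
  nondecreasing_seq (fun n => logpgf n s + ln (p mu) / mu%:R ^+ n).
Proof.
move=> s01; apply/nondecreasing_seqP => n; have f01 := pgf_iter_itv n s01.
have /andP[f0 f1] := f01; have /andP[g0 g1] := pgf_itv f01.
rewrite /logpgf /= -!mulrDl exprS invfM mulrA ler_pM2r ?invr_gt0 ?exprn_gt0//=.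
rewrite ler_pdivlMr// mulrC mulrDr.
have l0 : ln (p mu) <= 0.
  by have := err_ge0 0; rewrite /err expr0 divr1 oppr_ge0.
have : mu%:R * ln (p mu) <= 2 * ln (p mu).
  by rewrite ler_wnM2r// ler_nat mu_ge2.
have : ln (p mu) + mu%:R * ln (pgf_iter p n s) <= ln (pgf p (pgf_iter p n s)).
  rewrite mulr_natl -lnXn// -lnM ?posrE ?exprn_gt0//.
  by rewrite ler_ln ?posrE ?mulr_gt0 ?exprn_gt0// pgf_ge_pow// f1 ltW.
lra.
Qed.

Lemma le_logpgf n N s : 0 < s <= 1 -> (n <= N)%N ->
  logpgf n s + ln (p mu) / mu%:R ^+ n <= logpgf N s <= logpgf n s.
Proof.
move=> s01 nN; rewrite (nonincreasing_logpgf s01)// andbT.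
rewrite (le_trans (nondecreasing_logpgf s01 nN))// gerDl.
by have := err_ge0 N; rewrite /err mulNr oppr_ge0.
Qed.

(** The limit is taken on logarithms, where the sequence is monotone and bounded below. Hence [B(s)]
    is the exponential of a finite number, and [ln] is never applied to [0]. *)
Lemma cvg_logpgf s : 0 < s <= 1 ->
  (fun n => logpgf n s) @ \oo --> ln (Boettcher p mu s).
Proof.
move=> s01; have cvgb : cvgn (fun n => logpgf n s).
  apply: nonincreasing_is_cvgn; first exact: nonincreasing_logpgf.
  exists (logpgf 0 s + ln (p mu) / mu%:R ^+ 0) => _ [n _ <-].
  by have /andP[] := le_logpgf s01 (leq0n n).
suff -> : Boettcher p mu s = expR (limn (fun n => logpgf n s)) by rewrite expRK.
apply/cvg_lim => //.
rewrite (_ : (fun n => _) = expR \o (fun n => logpgf n s)); last first.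
  apply/funext => n /=; have /andP[f0 _] := pgf_iter_itv n s01.
  by rewrite /powR gt_eqF// /logpgf mulrC.
by apply: continuous_cvg => //; exact: continuous_expR.
Qed.

(** The error term in [le_logpgf] does not depend on [s], so the growing index [N n] can be replaced
    by a fixed [n0]; after that only the continuity of the single iterate [f_n0] at [l] matters. *)
Lemma cvg_logpgf_diag (x : nat -> R) (l : R) (N : nat -> nat) :
  (forall k, 0 < x k <= 1) -> 0 < l <= 1 -> x @ \oo --> l ->
  (forall K, \forall n \near \oo, (K <= N n)%N) ->
  (fun n => logpgf (N n) (x n)) @ \oo --> ln (Boettcher p mu l).
Proof.
move=> x01 l01 xl Noo; apply/cvgrPdist_le => e e0.
have e3 : 0 < e / 3 by rewrite divr_gt0.
have : (fun n => ln (p mu) / mu%:R ^+ n) @ \oo --> (0 : R).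
  rewrite -[X in _ --> X](mulr0 (ln (p mu))); apply: cvgMl_tmp.
  rewrite (_ : (fun n => _) = (fun n => mu%:R^-1 ^+ n)); last first.
    by apply/funext => n; rewrite exprVn.
  apply: cvg_expr; rewrite ger0_norm ?invr_ge0 ?ltW// invf_lt1// ltr1n.
  exact: mu_ge2.
move=> /cvgrPdist_le/(_ _ e3) [n1 _ n1P].
have [n2 _ n2P] := (cvgrPdist_le _ _).1 (cvg_logpgf l01) _ e3.
pose n0 := maxn n1 n2.
have /n1P : (n1 <= n0)%N by rewrite leq_maxl.
have /n2P : (n2 <= n0)%N by rewrite leq_maxr.
rewrite sub0r normrN => h2 h1.
have cb : (fun n => logpgf n0 (x n)) @ \oo --> logpgf n0 l.
  apply: cvgMr_tmp; apply: continuous_cvg; last exact: cvg_pgf_iter.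
  by apply: continuous_ln; have /andP[] := pgf_iter_itv n0 l01.
near=> n.
have h3 : `|logpgf n0 l - logpgf n0 (x n)| <= e / 3.
  by near: n; move/cvgrPdist_le : cb; exact.
have /(le_logpgf (x01 n))/andP[h4 h5] : (n0 <= N n)%N by near: n; exact: Noo.
move: h1 h2 h3; rewrite !ler_norml => /andP[? ?] /andP[? ?] /andP[? ?].
apply/andP; split; lra.
Unshelve. all: by end_near. Qed.

End pgf.

Lemma measurable_preimage {d d' : measure_display} {T : measurableType d}
    {T' : measurableType d'} (Y : T -> T') (A : set T') :
  measurable_fun setT Y -> measurable A -> measurable (Y @^-1` A).
Proof. by move=> mY mA; rewrite -[_ @^-1` _]setTI; exact: mY. Qed.

(** * Independence and product expectations *)

Section law_extension.
Context {R : realType} {d : measure_display} {T : measurableType d}.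
Variable P : {measure set T -> \bar R}.
Import HBNNSimple.
Local Open Scope ereal_scope.

Variables (D : set T) (H : T -> R) (Y Y' : T -> R) (c : R).
Hypotheses (mD : measurable D) (mH : measurable_fun setT H).
Hypothesis H0 : forall t, (0 <= H t)%R.
Hypotheses (mY : measurable_fun setT Y) (mY' : measurable_fun setT Y').
Hypothesis HYc : forall A, measurable A ->
  \int[P]_(t in D `&` Y @^-1` A) (H t)%:E = c%:E * P (Y' @^-1` A).

Let integral_law_nnsfun (f : {nnsfun R >-> R}) :
  \int[P]_(t in D) (H t * f (Y t))%:E = c%:E * \int[P]_t (f (Y' t))%:E.
Proof.
have mf r : measurable (f @^-1` [set r]) by exact: measurable_preimage.
have mfY r : measurable (Y @^-1` (f @^-1` [set r])) by exact: measurable_preimage.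
have mfY' r : measurable (Y' @^-1` (f @^-1` [set r])) by exact: measurable_preimage.
have mHD : measurable_fun D (fun t => (H t)%:E).
  by apply/measurable_EFinP; exact: measurable_funTS.
have f0 r : r \in range f -> (0 <= r)%R.
  by rewrite inE => -[x _ <-].
transitivity (\sum_(r \in range f)
    \int[P]_(t in D) (r%:E * ((\1_(Y @^-1` (f @^-1` [set r])) t)%:E * (H t)%:E))).
  (* [Num.max r 0] agrees with [r] on the range of [f] and makes every summand nonnegative for all
     [r], as the exchange of sum and integral demands. *)
  transitivity (\int[P]_(t in D) (\sum_(r \in range f)
      (Num.max r 0)%:E * ((\1_(Y @^-1` (f @^-1` [set r])) t)%:E * (H t)%:E))).
    apply: eq_integral => t _.
    rewrite [in LHS]fimfunE mulrC EFinM -fsumEFin// ge0_mule_fsuml//; last first.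
      by move=> r; exact: nnfun_muleindic_ge0.
    apply: eq_fsbigr => r /f0 r0; rewrite EFinM muleA; congr (_%:E * _ * _).
    by rewrite (max_idPl r0).
  rewrite ge0_integral_fsum//.
  - apply: eq_fsbigr => r /f0 r0; apply: eq_integral => t _.
    by rewrite (max_idPl r0).
  - move=> r; apply: emeasurable_funM => //; apply: emeasurable_funM => //.
    apply/measurable_EFinP; apply: measurable_funTS.
    exact/measurable_indicP.
  - move=> r t _; rewrite !mule_ge0// lee_fin//.
    by rewrite le_max lexx orbT.
transitivity (\sum_(r \in range f) r%:E * (c%:E * P (Y' @^-1` (f @^-1` [set r])))).
  apply: eq_fsbigr => r /f0 r0.
  rewrite ge0_integralZl_EFin//; last 2 first.
  - by move=> t _; rewrite mule_ge0// lee_fin.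
  - apply: emeasurable_funM => //.
    apply/measurable_EFinP; apply: measurable_funTS; exact/measurable_indicP.
  congr (_ * _); rewrite -HYc// setIC integral_mkcondl.
  apply: eq_integral => t _; rewrite patchE indicE; case: ifPn => /= _.
    by rewrite mul1e.
  by rewrite mul0e.
under [in RHS]eq_integral do rewrite fimfunE -fsumEFin//.
rewrite ge0_integral_fsum//; last 2 first.
- move=> r; apply/measurable_EFinP; apply: measurable_funM => //.
  apply: measurableT_comp => //; exact/measurable_indicP.
- by move=> r t _; rewrite nnfun_muleindic_ge0.
rewrite ge0_mule_fsumr; last first.
  by move=> r; apply: integral_ge0 => t _; rewrite nnfun_muleindic_ge0.
apply: eq_fsbigr => r /f0 r0.
under [in RHS]eq_integral do rewrite EFinM.
rewrite ge0_integralZl_EFin//; last first.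
  apply/measurable_EFinP.
  by apply: measurableT_comp => //; exact/measurable_indicP.
rewrite muleCA; congr (_ * (_ * _)).
have -> : P (Y' @^-1` (f @^-1` [set r])) =
    \int[P]_t (\1_(Y' @^-1` (f @^-1` [set r])) t)%:E.
  by rewrite integral_indic// setIT.
by apply: eq_integral => t _; rewrite !indicE.
Qed.

(* Both laws are compared on all measurable sets, so no pi-lambda argument is needed. *)
Lemma integral_law_ext (g : R -> R) :
  measurable_fun setT g -> (forall x, (0 <= g x)%R) ->
  \int[P]_(t in D) (H t * g (Y t))%:E = c%:E * \int[P]_t (g (Y' t))%:E.
Proof.
move=> mg g0.
have mEg : measurable_fun [set: R] (fun x => (g x)%:E) by exact/measurable_EFinP.
pose f := nnsfun_approx measurableT mEg.
have fg x : EFin \o f ^~ x @ \oo --> (g x)%:E.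
  by apply: (@cvg_nnsfun_approx _ _ _ _ measurableT _ mEg) => // y _; rewrite lee_fin.
have ndf x m n : (m <= n)%N -> (f m x <= f n x)%R.
  by move=> mn; exact/lefP/nd_nnsfun_approx.
have -> : \int[P]_(t in D) (H t * g (Y t))%:E =
    limn (fun n => \int[P]_(t in D) (H t * f n (Y t))%:E).
  rewrite -monotone_convergence//.
  - apply: eq_integral => t _; apply/esym/cvg_lim => //.
    under eq_fun do rewrite EFinM.
    by rewrite EFinM; apply: cvgeZl => //; exact: fg.
  - move=> n; apply/measurable_EFinP; apply: measurable_funM.
      exact: measurable_funTS.
    by apply: measurable_funTS; apply: measurableT_comp.
  - by move=> n t _; rewrite lee_fin mulr_ge0.
  - by move=> t _ m n mn; rewrite lee_fin ler_wpM2l// ndf.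
under eq_fun do rewrite integral_law_nnsfun.
apply/cvg_lim => //.
have : \int[P]_t (f n (Y' t))%:E @[n --> \oo] --> \int[P]_t (g (Y' t))%:E.
  have -> : \int[P]_t (g (Y' t))%:E =
     \int[P]_t limn (fun n => (f n (Y' t))%:E).
    by apply: eq_integral => t _; apply/esym/cvg_lim => //; exact: fg.
  apply: (@cvg_monotone_convergence _ _ _ _ _ _ (fun n t => (f n (Y' t))%:E)) => //.
  - by move=> n; apply/measurable_EFinP; apply: measurableT_comp.
  - by move=> n t _; rewrite lee_fin.
  - by move=> t _ m n mn; rewrite lee_fin ndf.
exact: cvgeZl.
Qed.

End law_extension.

Section independence.
Context {R : realType} {d : measure_display} {T : measurableType d}.
Variables (P : probability T R) (I : eqType) (Y : I -> T -> R).
Hypothesis mY : forall i, measurable_fun setT (Y i).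
Local Open Scope ereal_scope.

(** Independence of an event from a subfamily, tested on finite rectangles only. In this form it
    passes to intersections with a further variable and to countable disjoint unions, which is all
    that the trajectory events require. *)
Definition indep_event (Q : pred I) (D : set T) := measurable D /\
  forall (s : seq I) (A : I -> set R), uniq s -> all Q s ->
    (forall i, measurable (A i)) ->
    P (D `&` \bigcap_(i in [set` s]) (Y i @^-1` A i)) =
    P D * \prod_(i <- s) P (Y i @^-1` A i).

Lemma indep_event_setT : mutually_independent P Y -> indep_event predT setT.
Proof.
move=> iY; split => // s A us _ mA.
by rewrite setTI probability_setT mul1e; exact: iY.
Qed.

Lemma indep_eventW (Q Q' : pred I) D : {subset Q' <= Q} ->
  indep_event Q D -> indep_event Q' D.
Proof.
move=> QQ' [mD iD]; split => // s A us Qs mA; apply: iD => //.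
by apply/allP => i /(allP Qs)/QQ'.
Qed.

Lemma indep_event1 (Q : pred I) D j (B : set R) : indep_event Q D -> Q j ->
  measurable B -> P (D `&` Y j @^-1` B) = P D * P (Y j @^-1` B).
Proof.
move=> [mD iD] Qj mB.
have := iD [:: j] (fun=> B) erefl; rewrite /= Qj big_seq1 => <-//.
by rewrite set_cons1 bigcap_set1.
Qed.

Lemma indep_eventI (Q : pred I) D j (B : set R) : indep_event Q D -> Q j ->
  measurable B -> indep_event [pred i | Q i & i != j] (D `&` Y j @^-1` B).
Proof.
move=> iD Qj mB; split.
  by apply: measurableI; [exact: iD.1|exact: measurable_preimage].
move=> s A us Qs mA; rewrite (indep_event1 iD Qj mB).
have js : j \notin s by apply/negP => /(allP Qs) /=; rewrite eqxx andbF.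
(* With [B] placed in slot [j], the product formula for [j :: s] on [D] becomes the one for [s] on
   the smaller event. *)
pose A' i := if i == j then B else A i.
have A's i : i \in s -> A' i = A i.
  by move=> is_; rewrite /A'; case: eqP => // ij; move: is_; rewrite ij (negPf js).
have := iD.2 (j :: s) A'; rewrite /= js us Qj /= => /(_ erefl).
have -> : all Q s by apply/allP => i /(allP Qs)/andP[].
move=> /(_ erefl) iDj.
have A'j : A' j = B by rewrite /A' eqxx.
rewrite big_cons A'j muleA in iDj.
transitivity (P (D `&` \bigcap_(i in [set` j :: s]) (Y i @^-1` A' i))).
  congr (P _); apply/seteqP; split => t /=.
    move=> [[Dt Bt] At]; split => // i /=; rewrite inE => /predU1P[->|is_].
      by rewrite A'j.
    by rewrite A's//; exact: At.
  move=> [Dt At]; split.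
    by split => //; rewrite -A'j; apply: (At j) => /=; rewrite inE eqxx.
  by move=> i /= is_; rewrite -A's//; apply: (At i) => /=; rewrite inE is_ orbT.
rewrite iDj; last by move=> i; rewrite /A'; case: ifP.
by congr (_ * _); rewrite big_seq [RHS]big_seq; apply: eq_bigr => i /A's ->.
Qed.

Lemma indep_event_bigcup (Q : pred I) (F : (set T)^nat) : trivIset setT F ->
  (forall k, indep_event Q (F k)) -> indep_event Q (\bigcup_k F k).
Proof.
move=> tF iF; have mF k : measurable (F k) := (iF k).1.
split; first exact: bigcupT_measurable.
move=> s A us Qs mA.
have mB : measurable (\bigcap_(i in [set` s]) (Y i @^-1` A i)).
  by apply: fin_bigcap_measurable => // i _; exact: measurable_preimage.
rewrite setI_bigcupl measure_bigcup//; last 2 first.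
- by move=> k _; exact: measurableI.
- by apply: trivIset_setIr.
rewrite measure_bigcup//.
have pfin : \prod_(i <- s) P (Y i @^-1` A i) \is a fin_num.
  rewrite big_seq; apply: (big_ind (fun x => x \is a fin_num)) => // [x y|i _].
    exact: fin_numM.
  by apply: fin_num_measure; exact: measurable_preimage.
rewrite muleC -(fineK pfin) -nneseriesZl//.
by apply: eq_eseriesr => k _; rewrite fineK// muleC; exact: (iF k).2.
Qed.

Lemma integral_indep_prod (g : I -> R -> R) (e : I -> R) :
  (forall i, measurable_fun setT (g i)) -> (forall i x, (0 <= g i x)%R) ->
  (forall i, \int[P]_t (g i (Y i t))%:E = (e i)%:E) ->
  forall (s : seq I) (Q : pred I) (D : set T), uniq s -> all Q s -> indep_event Q D ->
  \int[P]_(t in D) (\prod_(i <- s) g i (Y i t))%:E = P D * (\prod_(i <- s) e i)%:E.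
Proof.
move=> mg g0 ge.
elim => [|j s ih] Q D.
  move=> _ _ [mD _]; under eq_integral do rewrite big_nil.
  by rewrite integral_cst// mul1e big_nil mule1.
move=> /= /andP[js us] /andP[Qj Qs] iD; have mD := iD.1.
have PDfin : P D \is a fin_num by exact: fin_num_measure.
under eq_integral do rewrite big_cons mulrC.
rewrite (@integral_law_ext _ _ _ P D (fun t => \prod_(i <- s) g i (Y i t))%R
  (Y j) (Y j) (fine (P D) * \prod_(i <- s) e i)%R) //.
- by rewrite ge EFinM fineK// -muleA -EFinM big_cons mulrC.
- apply: measurable_prod => i _; exact: measurableT_comp.
- by move=> t; apply: prodr_ge0.
- move=> A mA; rewrite (ih [pred i | Q i & i != j])//.
  + by rewrite (indep_event1 iD Qj mA) EFinM fineK// -!muleA; congr (_ * _); rewrite muleC.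
  + apply/allP => i is_ /=; rewrite (allP Qs)//=; apply: contraNneq js => <- //.
  + exact: indep_eventI.
Qed.

End independence.

(** * Integration along the fibres of a countably valued map *)

Section fibers.
Context {R : realType} {d : measure_display} {T : measurableType d}.
Variables (P : {measure set T -> \bar R}) (N : T -> nat).
Hypothesis mN : forall c, measurable (N @^-1` [set c]).

(** Every preimage under [f] is a union of fibres of [N], and there are only countably many of
    them. *)
Lemma measurable_fun_fibers {d' : measure_display} {T' : measurableType d'} (f : T -> T') :
  (forall t t', N t = N t' -> f t = f t') -> measurable_fun setT f.
Proof.
move=> Nf _ B mB; rewrite setTI.
have -> : f @^-1` B = \bigcup_(c in N @` (f @^-1` B)) (N @^-1` [set c]).
  apply/seteqP; split => [t Bt|t [_ [t' Bt' <-] /=]]; first by exists (N t) => //; exists t.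
  by move=> /Nf; rewrite /preimage /= => ->.
exact: bigcup_measurable.
Qed.

Lemma integral_fibers (u : T -> \bar R) :
  measurable_fun setT u -> (forall t, 0 <= u t)%E ->
  (\int[P]_t u t = \sum_(c <oo) \int[P]_(t in N @^-1` [set c]) u t)%E.
Proof.
move=> mu u0; rewrite -ge0_integral_bigcup//.
- by congr integral; apply/seteqP; split => // t _; exists (N t).
- exact: measurable_funTS.
- by move=> i j _ _ [t [<- <-]].
Qed.

Lemma eq_integral_fibers (u v : T -> \bar R) :
  measurable_fun setT u -> measurable_fun setT v ->
  (forall t, 0 <= u t)%E -> (forall t, 0 <= v t)%E ->
  (forall c, \int[P]_(t in N @^-1` [set c]) u t = \int[P]_(t in N @^-1` [set c]) v t)%E ->
  (\int[P]_t u t = \int[P]_t v t)%E.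
Proof.
move=> mu mv u0 v0 uv; rewrite integral_fibers// [RHS]integral_fibers//.
by apply: eq_eseriesr => c _.
Qed.

Lemma le_integral_fibers (u v : T -> \bar R) :
  measurable_fun setT u -> measurable_fun setT v ->
  (forall t, 0 <= u t)%E -> (forall t, 0 <= v t)%E ->
  (forall c, \int[P]_(t in N @^-1` [set c]) u t <= \int[P]_(t in N @^-1` [set c]) v t)%E ->
  (\int[P]_t u t <= \int[P]_t v t)%E.
Proof.
move=> mu mv u0 v0 uv; rewrite integral_fibers// [leRHS]integral_fibers//.
apply: lee_nneseries => // c _ _; exact: integral_ge0.
Qed.

End fibers.

(** * Galton-Watson trajectories *)

Section galton_watson.
Context {R : realType} {d : measure_display} {T : measurableType d}.
Variables (P : probability T R) (p : nat -> R) (m : R).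
Variables (xi : nat -> nat -> T -> nat) (X : nat -> T -> R).
Let Y (j : (nat * nat) + nat) : T -> R :=
  match j with inl (n, i) => fun t => (xi n i t)%:R | inr i => X i end.
Hypothesis mxi : forall n i, measurable_fun setT (fun t => (xi n i t)%:R : R).
Hypothesis xip : forall n i k, P [set t | xi n i t = k] = (p k)%:E.
Hypothesis mX : forall i, measurable_fun setT (X i).
Hypothesis iY : mutually_independent P Y.
Notation Z := (GW xi).

Let mY j : measurable_fun setT (Y j).
Proof. by case: j => [[n i]|i]; [exact: mxi|exact: mX]. Qed.

Let measurable_xi n i k : measurable [set t | xi n i t = k].
Proof.
have -> : [set t | xi n i t = k] = (fun t => (xi n i t)%:R) @^-1` [set k%:R : R].
  apply/seteqP; split => t /=; first by move=> ->.
  by move=> /eqP; rewrite eqr_nat => /eqP.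
exact: measurable_preimage.
Qed.

(* The variables not consumed by the first n generations and the first j
   reproductions of generation n. *)
Definition unused (n j : nat) : pred ((nat * nat) + nat) := fun a =>
  match a with inl (k, i) => (n < k)%N || (k == n) && (j <= i)%N | inr _ => true end.

(* A code for the trajectory Z_1, ..., Z_n. *)
Fixpoint hist (n : nat) (t : T) : nat :=
  if n is n'.+1 then pickle (hist n' t, Z n'.+1 t) else 0%N.

Lemma histP n t t' : hist n t = hist n t' -> forall k, (k <= n)%N -> Z k t = Z k t'.
Proof.
elim: n => [_ [|//]//|n ih].
move=> /(pcan_inj (@pickleK _)) [/ih hn Zn] k.
by rewrite leq_eqVlt => /predU1P[->//|]; exact: hn.
Qed.

Lemma hist_le n t t' : hist n t = hist n t' ->
  forall k, (k <= n)%N -> hist k t = hist k t'.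
Proof.
elim: n => [_ [|//]//|n ih] hn k.
rewrite leq_eqVlt => /predU1P[->//|]; apply: ih.
by move: hn => /(pcan_inj (@pickleK _)) [].
Qed.

Let indep := indep_event P Y.

Let indep_set0 Q : indep Q set0.
Proof. by split => // s A us Qs mA; rewrite set0I measure0 mul0e. Qed.

(** Induction on [j]: the event is split by the number [l] of children of individual [j]. Each piece
    uses up exactly the variable [inl (n, j)], and the pieces are disjoint. *)
Lemma indep_offspring_sum n D j : indep (unused n 0) D -> forall k,
  indep (unused n j) (D `&` [set t | (\sum_(i < j) xi n i t)%N = k]).
Proof.
move=> iD; elim: j => [|j ih] k.
  have [->|k0] := eqVneq k 0%N.
    rewrite (_ : [set t | _] = setT) ?setIT//.
    by apply/seteqP; split => // t _ /=; rewrite big_ord0.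
  rewrite (_ : [set t | _] = set0) ?setI0//.
  by apply/seteqP; split => // t /=; rewrite big_ord0 => /esym/eqP; rewrite (negPf k0).
(* The guard [l <= k] is needed because [k - l] is truncated: without it, pieces with [l > k] would
   not lie in the event. *)
pose F l := if (l <= k)%N then
  (D `&` [set t | (\sum_(i < j) xi n i t)%N = (k - l)%N]) `&` (Y (inl (n, j)) @^-1` [set l%:R])
  else set0.
have Fxi l t : F l t -> xi n j t = l.
  rewrite /F; case: ifP => // _ [_ /= /eqP]; by rewrite eqr_nat => /eqP.
have -> : D `&` [set t | (\sum_(i < j.+1) xi n i t)%N = k] = \bigcup_l F l.
  apply/seteqP; split => t.
    move=> [Dt /=]; rewrite big_ord_recr/= => sk; exists (xi n j t) => //.
    by rewrite /F -sk leq_addl; split => //; split => //=; rewrite addnK.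
  move=> [l _ Flt]; have := Flt; rewrite /F; case: ifPn => // lk [[Dt /= sj] _].
  by split => //=; rewrite big_ord_recr/= sj (Fxi _ _ Flt) subnK.
apply: indep_event_bigcup => //.
  by move=> l l' _ _ [t [/Fxi <- /Fxi <-]].
move=> l; rewrite /F; case: ifPn => [lk|_]; last exact: indep_set0.
apply: indep_eventW; last first.
  by apply: (indep_eventI mY (ih (k - l)%N) _ (measurable_set1 _)); rewrite /= eqxx leqnn orbT.
move=> [[a b]|a]; rewrite !inE /unused //=.
case/orP => [na|/andP[/eqP -> jb]].
  rewrite na /=; apply/eqP => -[an _]; by rewrite an ltnn in na.
rewrite eqxx (ltnW jb) orbT /=; apply/eqP => -[bj]; by rewrite bj ltnn in jb.
Qed.

(** On a fibre of [hist n] the size [Z n] is the constant [Z n t0], so a fibre of [hist n.+1] is a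
    fibre of [hist n] cut by an event on a sum with a deterministic number of terms. *)
Lemma indep_hist n c : indep (unused n 0) (hist n @^-1` [set c]).
Proof.
elim: n c => [|n ih] c.
  have [->|c0] := eqVneq c 0%N.
    rewrite (_ : _ @^-1` _ = setT); last by apply/seteqP; split.
    by apply: indep_eventW (indep_event_setT iY).
  rewrite (_ : _ @^-1` _ = set0)//; apply/seteqP; split => // t /= /esym/eqP.
  by rewrite (negPf c0).
have [[t0 ht0]|nex] := pselect (exists t0, hist n.+1 t0 = c); last first.
  rewrite (_ : _ @^-1` _ = set0)//; apply/seteqP; split => // t /= htc.
  by apply: nex; exists t.
have -> : hist n.+1 @^-1` [set c] = hist n @^-1` [set hist n t0] `&`
    [set t | (\sum_(i < Z n t0) xi n i t)%N = Z n.+1 t0].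
  rewrite -ht0; apply/seteqP; split => t.
    move=> h; have h' := histP h; split.
      by move: h => /(pcan_inj (@pickleK _)) [].
    suff : (\sum_(i < Z n t0) xi n i t)%N = Z n.+1 t0 by [].
    by rewrite -(h' n.+1)//= (h' n).
  move=> [/= h s]; rewrite /preimage /=; congr (pickle (_, _)) => //.
  by rewrite -[RHS]s (histP h).
apply: indep_eventW (indep_offspring_sum (Z n t0) (ih _) _).
move=> [[a b]|a]; rewrite /in_mem //= andbT.
by case/orP => [/ltnW ->//|/eqP ->]; rewrite leqnn.
Qed.

Lemma measurable_hist n c : measurable (hist n @^-1` [set c]).
Proof. exact: (indep_hist n c).1. Qed.

(** An event determined by the trajectory is a countable disjoint union of fibres; events such as
    [Z n = k] are handled this way. *)
Lemma indep_hist_saturated n (D : set T) :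
  (forall t t', hist n t = hist n t' -> D t -> D t') -> indep (unused n 0) D.
Proof.
move=> hD.
pose F c := if `[< exists2 t, D t & hist n t = c >] then hist n @^-1` [set c] else set0.
have -> : D = \bigcup_c F c.
  apply/seteqP; split => t.
    move=> Dt; exists (hist n t) => //; rewrite /F; case: asboolP => // -[]; by exists t.
  move=> [c _]; rewrite /F; case: asboolP => // -[t' Dt' <-] /= h.
  exact: (hD t').
apply: indep_event_bigcup => //.
  move=> a b _ _ [t []]; rewrite /F; case: ifP => // _ /= <-; by case: ifP.
by move=> c; rewrite /F; case: ifP => _; [exact: indep_hist|exact: indep_set0].
Qed.

Lemma measurable_GW n k : measurable (Z n @^-1` [set k]).
Proof.
apply: (indep_hist_saturated (n := n) _).1 => t t' h /=.
by rewrite (histP h).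
Qed.

Lemma measurable_fun_GW n {d' : measure_display} {T' : measurableType d'} (f : nat -> T') :
  measurable_fun setT (fun t => f (Z n t)).
Proof.
by apply: (measurable_fun_fibers (measurable_GW n)) => t t' ->.
Qed.

Lemma integral_offspring n i (h : nat -> R) (l : R) : (forall k, 0 <= h k) ->
  series (fun k => h k * p k) @ \oo --> l ->
  (\int[P]_t (h (xi n i t))%:E = l%:E)%E.
Proof.
move=> h0 hl.
have mxi' k : measurable (xi n i @^-1` [set k]) by exact: measurable_xi.
rewrite (integral_fibers P mxi'); last 2 first.
- by apply: (measurable_fun_fibers mxi') => t t' ->.
- by move=> t; rewrite lee_fin.
transitivity (\sum_(k <oo) (h k * p k)%:E)%E.
  apply: eq_eseriesr => k _.
  rewrite (eq_integral (cst (h k)%:E)); last by move=> t; rewrite inE /= => ->.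
  by rewrite integral_cst// EFinM; congr (_ * _)%E; exact: xip.
apply/cvg_lim => //.
rewrite (_ : (fun n => _) = EFin \o series (fun k => h k * p k)); last first.
  by apply/funext => k /=; rewrite sumEFin.
by apply: cvg_comp hl _ => //.
Qed.

Lemma integral_offspring_prod n c t0 (g : R -> R) (e : R) :
  measurable_fun setT g -> (forall x, 0 <= g x) ->
  (forall i, \int[P]_t (g (xi n i t)%:R)%:E = e%:E)%E ->
  hist n t0 = c ->
  (\int[P]_(t in hist n @^-1` [set c]) (\prod_(i < Z n t) g (xi n i t)%:R)%:E =
   P (hist n @^-1` [set c]) * (e ^+ Z n t0)%:E)%E.
Proof.
move=> mg g0 ge ht0.
(* The product formula expects a function and its mean for every index; those outside generation [n]
   get the constant [1]. *)
pose G (j : (nat * nat) + nat) : R -> R := if j is inl (n', _) then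
  if n' == n then g else cst 1 else cst 1.
pose E (j : (nat * nat) + nat) : R := if j is inl (n', _) then
  if n' == n then e else 1 else 1.
have GE j : (\int[P]_t (G j (Y j t))%:E = (E j)%:E)%E.
  have int1 : (\int[P]_t (1 : R)%:E = 1%:E)%E.
    by rewrite integral_cst// mul1e; exact: probability_setT.
  case: j => [[n' i]|i]; last exact: int1.
  by rewrite /=; case: eqP => [->|_]; [exact: ge|exact: int1].
have mG j : measurable_fun setT (G j).
  by case: j => [[n' i]|i] //=; case: eqP.
have G0 j x : 0 <= G j x by case: j => [[n' i]|i] //=; case: eqP.
pose s : seq ((nat * nat) + nat) := [seq inl (n, i) | i <- iota 0 (Z n t0)].
have prods (f : (nat * nat) + nat -> R) :
    \prod_(j <- s) f j = \prod_(i < Z n t0) f (inl (n, val i)).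
  by rewrite big_map -[in LHS](subn0 (Z n t0)) big_mkord.
have us : uniq s by rewrite map_inj_uniq ?iota_uniq// => i j [].
have Qs : all (unused n 0) s.
  by rewrite all_map; apply/allP => i _ /=; rewrite eqxx orbT.
transitivity (\int[P]_(t in hist n @^-1` [set c]) (\prod_(j <- s) G j (Y j t))%:E)%E.
  apply: eq_integral => t; rewrite inE /= -ht0 => /histP -> //.
  by rewrite prods; congr EFin; apply: eq_bigr => i _ /=; rewrite eqxx.
rewrite (integral_indep_prod mY mG G0 GE us Qs (indep_hist n c)); congr (_ * _%:E)%E.
by rewrite prods /= eqxx prodr_const card_ord.
Qed.

Lemma hist_fiber_cases n c :
  hist n @^-1` [set c] = set0 \/ exists t0, hist n t0 = c.
Proof.
have [|nex] := pselect (exists t0, hist n t0 = c); [by right|left].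
by apply/seteqP; split => // t /= htc; apply: nex; exists t.
Qed.

Lemma measurable_fun_hist n {d' : measure_display} {T' : measurableType d'} (f : T -> T') :
  (forall t t', hist n t = hist n t' -> f t = f t') -> measurable_fun setT f.
Proof. by move=> fh; exact: (measurable_fun_fibers (measurable_hist n) fh). Qed.

Variable mu : nat.
Hypotheses (p_ge0 : forall k, 0 <= p k) (p_sum : series p @ \oo --> (1 : R)).
Hypothesis p_mean : series (fun k => k%:R * p k) @ \oo --> m.
Hypotheses (p_mu : 0 < p mu) (p_lt_mu : forall k, (k < mu)%N -> p k = 0).

(** Branching property: on each fibre of [hist n] the variables [s^xi] are independent with mean
    [f(s)], so [s^Z_(n+1)] and [f(s)^Z_n] have the same integral. The induction hypothesis is then
    used at [f(s)]. *)
Lemma integral_GW_pgf n s : 0 < s <= 1 ->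
  (\int[P]_t (s ^+ Z n t)%:E = (pgf_iter p n s)%:E)%E.
Proof.
elim: n s => [|n ih] s s01.
  under eq_integral do rewrite expr1.
  rewrite integral_cst// -[RHS]mule1; congr (_ * _)%E; exact: probability_setT.
have /andP[s0 s1] := s01.
have f01 := pgf_itv p_ge0 p_sum p_mu p_lt_mu s01; have /andP[f0 f1] := f01.
rewrite /pgf_iter iterSr -/(pgf_iter p n (pgf p s)) -ih//.
apply: (eq_integral_fibers (measurable_hist n)).
- apply/measurable_EFinP; exact: (measurable_fun_GW n.+1 (fun z => s ^+ z)).
- apply/measurable_EFinP; exact: (measurable_fun_GW n (fun z => pgf p s ^+ z)).
- by move=> t; rewrite lee_fin exprn_ge0// ltW.
- by move=> t; rewrite lee_fin exprn_ge0// ltW.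
move=> c; have [->|[t0 ht0]] := hist_fiber_cases n c; first by rewrite !integral_set0.
(* The offspring numbers enter the independent family as reals, so [s^k] has to be read as a real
   power. *)
transitivity (\int[P]_(t in hist n @^-1` [set c])
    (\prod_(i < Z n t) s `^ (xi n i t)%:R)%:E)%E.
  apply: eq_integral => t _; rewrite /= -prodrXr; congr EFin.
  by apply: eq_bigr => i _; rewrite powR_mulrn// ltW.
rewrite (integral_offspring_prod (t0 := t0) (e := pgf p s))//.
- rewrite muleC -integral_cst//; last exact: measurable_hist.
  by apply: eq_integral => t; rewrite inE /= -ht0 => /histP ->.
- exact: measurable_powRr.
- by move=> x; exact: powR_ge0.
- move=> i; under eq_integral do rewrite powR_mulrn ?(ltW s0)//.
  apply: (@integral_offspring n i (fun k => s ^+ k)).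
    by move=> k; rewrite exprn_ge0// ltW.
  under eq_fun do rewrite mulrC.
  by apply: (cvg_pgf p_ge0 p_sum); rewrite s1 ltW.
Qed.

Lemma integral_hist_offspring n c i :
  (\int[P]_(t in hist n @^-1` [set c]) (xi n i t)%:R%:E =
   P (hist n @^-1` [set c]) * m%:E)%E.
Proof.
(* The absolute value only ensures nonnegativity on the whole line; it is the identity on offspring
   numbers. *)
pose G (j : (nat * nat) + nat) : R -> R := if j is inl _ then (fun x => `|x|) else cst 1.
pose E (j : (nat * nat) + nat) : R := if j is inl _ then m else 1.
have GE j : (\int[P]_t (G j (Y j t))%:E = (E j)%:E)%E.
  case: j => [[n' i']|i'] /=.
    under eq_integral do rewrite ger0_norm//.
    exact: (@integral_offspring n' i' (fun k => k%:R)).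
  by rewrite integral_cst// mul1e; exact: probability_setT.
have mG j : measurable_fun setT (G j).
  by case: j => [[n' i']|i'] //=; exact: normr_measurable.
have G0 j x : 0 <= G j x by case: j => [[n' i']|i'] //=.
have := integral_indep_prod mY mG G0 GE (s := [:: inl (n, i)]) (Q := unused n 0)
  erefl _ (indep_hist n c).
rewrite /= eqxx orbT => /(_ erefl); rewrite big_seq1 /= => <-.
by apply: eq_integral => t _; rewrite big_seq1 /= ger0_norm.
Qed.

(** The martingale property in integrated form: testing against all nonnegative functions [g] of the
    trajectory replaces the conditional expectation. *)
Lemma integral_GW_martingale n (g : T -> R) : (forall t, 0 <= g t) ->
  (forall t t', hist n t = hist n t' -> g t = g t') ->
  (\int[P]_t (g t * (Z n.+1 t)%:R)%:E = \int[P]_t (g t * (m * (Z n t)%:R))%:E)%E.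
Proof.
move=> g0 gh.
have m0 : 0 <= m.
  by apply: (le_cvg_series _ _ p_mean (a := 0)) => [k|]; [exact: (mulr_ge0 _ (p_ge0 k))|
     rewrite (_ : series _ = cst 0); [exact: cvg_cst|apply/funext => k; rewrite /series /= big1]].
have mg : measurable_fun setT g by exact: (measurable_fun_hist gh).
have mZ k : measurable_fun setT (fun t => (Z k t)%:R : R).
  exact: (measurable_fun_GW k (fun z => z%:R : R)).
apply: (eq_integral_fibers (measurable_hist n)).
- by apply/measurable_EFinP; exact: measurable_funM.
- by apply/measurable_EFinP; apply: measurable_funM => //; exact: measurable_funM.
- by move=> t; rewrite lee_fin mulr_ge0.
- by move=> t; rewrite lee_fin !mulr_ge0.
move=> c; have [->|[t0 ht0]] := hist_fiber_cases n c; first by rewrite !integral_set0.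
have mD := measurable_hist n c.
transitivity ((g t0)%:E * \int[P]_(t in hist n @^-1` [set c])
    \sum_(i < Z n t0) (xi n i t)%:R%:E)%E.
  rewrite -ge0_integralZl_EFin//.
  - apply: eq_integral => t; rewrite inE /= -ht0 => h.
    by rewrite (gh _ _ h) (histP h)// EFinM sumEFin natr_sum.
  - by move=> t _; apply: sume_ge0 => i _; rewrite lee_fin.
  - apply: emeasurable_sum => i; apply/measurable_EFinP; exact: measurable_funTS.
rewrite ge0_integral_sum//; last first.
  by move=> i; apply/measurable_EFinP; exact: measurable_funTS.
under eq_bigr do rewrite integral_hist_offspring.
transitivity (\int[P]_(t in hist n @^-1` [set c]) (g t0 * (m * (Z n t0)%:R))%:E)%E.
  rewrite integral_cst//.
  have PDfin : P (hist n @^-1` [set c]) \is a fin_num by exact: fin_num_measure.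
  have [r Pr] : exists r, P (hist n @^-1` [set c]) = r%:E.
    by exists (fine (P (hist n @^-1` [set c]))); rewrite fineK.
  rewrite [RHS](_ : _ = (g t0 * (m * (Z n t0)%:R) * r)%:E); last first.
    by rewrite [RHS]EFinM; congr (_ * _)%E; exact: Pr.
  rewrite Pr -!EFinM sumEFin sumr_const card_ord -EFinM; congr EFin.
  by rewrite -[_ *+ _]mulr_natr [r * m]mulrC -!mulrA; congr (_ * (_ * _)); rewrite mulrC.
by apply: eq_integral => t; rewrite inE /= -ht0 => h; rewrite (gh _ _ h) (histP h).
Qed.

End galton_watson.

(** * Martingale convergence *)

Section upcrossing.
Context {R : realType}.
Implicit Types (a b : R) (x y : nat -> R).

(* The first component tells whether x has been below a since the last
   completed upcrossing of [a, b], the second one counts completed upcrossings. *)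
Fixpoint upcrossing a b x (n : nat) : bool * nat :=
  if n is n'.+1 then
    let: (h, u) := upcrossing a b x n' in
    if h then (if b <= x n then (false, u.+1) else (true, u)) else (x n <= a, u)
  else (x 0%N <= a, 0%N).

Lemma eq_upcrossing a b x y n : (forall k, (k <= n)%N -> x k = y k) ->
  upcrossing a b x n = upcrossing a b y n.
Proof.
elim: n => [|n ih] xy /=; first by rewrite xy.
by rewrite ih ?xy// => k kn; rewrite xy// ltnW.
Qed.

(** The gain of the strategy that holds one unit while the flag is up. Purchases and sales stand on
    opposite sides, so that both sides are nonnegative and can be integrated before anything is
    cancelled. *)
Lemma upcrossing_gain a b x n : 0 <= a -> (forall k, 0 <= x k) ->
  (b - a) * (upcrossing a b x n).2%:R + \sum_(k < n) (upcrossing a b x k).1%:R * x k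
  <= a + \sum_(k < n) (upcrossing a b x k).1%:R * x k.+1.
Proof.
(* The extra term is the value, relative to [a], of the unit still held; it is at least [- a] since
   [x] is nonnegative. With it the inequality is inductive. *)
move=> a0 x0; suff : (b - a) * (upcrossing a b x n).2%:R
    + \sum_(k < n) (upcrossing a b x k).1%:R * x k
    + (upcrossing a b x n).1%:R * (x n - a)
  <= \sum_(k < n) (upcrossing a b x k).1%:R * x k.+1.
  by have := x0 n; case: (upcrossing a b x n).1 => /= *; lra.
elim: n => [|n ih].
  rewrite !big_ord0 /= mulr0 !add0r.
  by case: (boolP (x 0%N <= a)) => xa /=; lra.
rewrite !big_ord_recr /=; move: ih; case: (upcrossing a b x n) => [[] u] /=.
  case: ifPn => bx /=; rewrite -?natr1; lra.
by case: (boolP (x n.+1 <= a)) => xa /=; lra.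
Qed.

Lemma nondecreasing_upcrossing a b x n k : (n <= k)%N ->
  ((upcrossing a b x n).2 <= (upcrossing a b x k).2)%N.
Proof.
elim: k => [|k ih]; first by rewrite leqn0 => /eqP ->.
rewrite leq_eqVlt => /predU1P[->//|/ih] /leq_trans; apply => /=.
by case: (upcrossing a b x k) => [[] u]; first case: ifP.
Qed.

Lemma upcrossing_unbounded a b x :
  (forall N, exists2 n, (N <= n)%N & x n <= a) ->
  (forall N, exists2 n, (N <= n)%N & b <= x n) ->
  forall K, exists n, (K <= (upcrossing a b x n).2)%N.
Proof.
move=> xa xb; elim => [|K [n Kn]]; first by exists 0%N.
have [n1 nn1 hn1] : exists2 n1, (n <= n1)%N & (upcrossing a b x n1).1.
  have [[|n'] // nn' xn'] := xa n.+1.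
  case hn' : (upcrossing a b x n').1; first by exists n'.
  exists n'.+1; first exact: ltnW.
  by move: hn' => /=; case: (upcrossing a b x n') => [[] u].
(* After [n1] the flag remains up until an upcrossing is completed, so the next visit above [b]
   completes one at the latest. *)
have stay j : ((upcrossing a b x n1).2 < (upcrossing a b x (n1 + j)).2)%N \/
    (upcrossing a b x (n1 + j)).1.
  elim: j => [|j]; first by rewrite addn0; right.
  rewrite addnS; case => [lt_u|].
    by left; apply: leq_trans lt_u _; exact: nondecreasing_upcrossing.
  have := nondecreasing_upcrossing a b x (leq_addr j n1).
  rewrite /=; case: (upcrossing a b x (n1 + j)) => [[] u] //= le_u _.
  by case: ifP => /= _; [left|right].
have [[|n2] // n12 xn2] := xb n1.+1.
exists n2.+1; rewrite ltnS in n12.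
have Kn1 : (K <= (upcrossing a b x n1).2)%N.
  by rewrite (leq_trans Kn)// nondecreasing_upcrossing.
have [|] := stay (n2 - n1)%N; rewrite subnKC//.
  move=> lt_u; rewrite (leq_ltn_trans Kn1)// (leq_trans lt_u)//.
  exact: nondecreasing_upcrossing.
have := nondecreasing_upcrossing a b x n12.
rewrite /=; case: (upcrossing a b x n2) => [[] u] //= le_u _.
by rewrite xn2 /= ltnS (leq_trans Kn1).
Qed.

Lemma limn_einf_ge (x : nat -> R) a : (\forall n \near \oo, a <= x n) ->
  (a%:E <= limn_einf (EFin \o x))%E.
Proof.
move=> [N _ ax]; rewrite limn_einf_lim; apply: lime_ge; first exact: is_cvg_einfs.
exists N => // n /= Nn; apply: le_ereal_inf_tmp => _ [k /= nk <-].
by rewrite lee_fin; apply: ax; exact: leq_trans nk.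
Qed.

Lemma limn_esup_le (x : nat -> R) a : (\forall n \near \oo, x n <= a) ->
  (limn_esup (EFin \o x) <= a%:E)%E.
Proof.
move=> [N _ ax]; rewrite limn_esup_lim; apply: lime_le; first exact: is_cvg_esups.
exists N => // n /= Nn; apply: ge_ereal_sup => _ [k /= nk <-].
by rewrite lee_fin; apply: ax; exact: leq_trans nk.
Qed.

Lemma limn_einf_esup_cvg (u : nat -> \bar R) (l : \bar R) :
  limn_einf u = l -> limn_esup u = l -> u @ \oo --> l.
Proof.
move=> ul lu; apply: (@squeeze_cvge _ _ _ _ (einfs u) u (esups u)).
- apply: nearW => n; apply/andP; split.
    by apply: ereal_inf_lbound; exists n => /=.
  by apply: ereal_sup_ubound; exists n => /=.
- by rewrite -ul limn_einf_lim; exact: is_cvg_einfs.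
- by rewrite -lu limn_esup_lim; exact: is_cvg_esups.
Qed.

(** If the lower limit were below the upper one, two rational levels would fit strictly between them
    and be crossed infinitely often. Rational levels keep the exceptional null sets countable in
    number; a finite lower limit rules out divergence to [+oo]. *)
Lemma cvg_bounded_upcrossing x : (forall n, 0 <= x n) ->
  (limn_einf (EFin \o x) < +oo)%E ->
  (forall qa qb : rat, 0 <= qa -> qa < qb ->
    exists K, forall n, ((upcrossing (ratr qa) (ratr qb) x n).2 < K)%N) ->
  cvgn x.
Proof.
move=> x0 liminf_lty upc.
have l0 : (0 <= limn_einf (EFin \o x))%E by apply: limn_einf_ge; exact: nearW.
case El : (limn_einf (EFin \o x)) liminf_lty l0 => [l| |]// _ l0.
have [|lt_lL] := leP (limn_esup (EFin \o x)) (limn_einf (EFin \o x)).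
  move=> Ll; apply/cvg_ex; exists l.
  suff : EFin \o x @ \oo --> l%:E by move=> /fine_cvgP[].
  apply: limn_einf_esup_cvg => //; apply/eqP; rewrite eq_le -{1}El Ll /=.
  by rewrite -El limn_einf_sup.
have [r lr rL] : exists2 r : R, l < r & (r%:E < limn_esup (EFin \o x))%E.
  move: lt_lL; rewrite El; case: (limn_esup _) => [L| |]//.
    rewrite lte_fin => lL; exists ((l + L) / 2); first lra.
    by rewrite lte_fin; lra.
  by move=> _; exists (l + 1); [lra|rewrite ltry].
have [qb lqb] := rat_in_itvoo lr; rewrite in_itv /= in lqb; case/andP: lqb => lqb qbr.
have [qa lqa] := rat_in_itvoo lqb; rewrite in_itv /= in lqa; case/andP: lqa => lqa qaqb.
have [K Kn] : exists K, forall n, ((upcrossing (ratr qa) (ratr qb) x n).2 < K)%N.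
  apply: upc; last by rewrite -(ltr_rat R).
  by rewrite -(ler_rat R) rmorph0 ltW// (le_lt_trans _ lqa)// -lee_fin.
have [||n] := upcrossing_unbounded (a := ratr qa) (b := ratr qb) (x := x) _ _ K; last first.
- by rewrite leqNgt Kn.
- move=> N; apply: contrapT => nex.
  have : (limn_esup (EFin \o x) <= (ratr qb)%:E)%E.
    apply: limn_esup_le; exists N => // n /= Nn; rewrite leNgt.
    by apply/negP => /ltW bx; apply: nex; exists n.
  by rewrite leNgt (lt_trans _ rL)// lte_fin.
- move=> N; apply: contrapT => nex.
  have : ((ratr qa)%:E <= limn_einf (EFin \o x))%E.
    apply: limn_einf_ge; exists N => // n /= Nn; rewrite leNgt.
    by apply/negP => /ltW bx; apply: nex; exists n.
  by rewrite El leNgt lte_fin lqa.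
Qed.

End upcrossing.

Section martingale_convergence.
Context {R : realType} {d : measure_display} {T : measurableType d}.
Variables (P : probability T R) (H : nat -> T -> nat) (M : nat -> T -> R).
Hypothesis mH : forall n c, measurable (H n @^-1` [set c]).
Hypothesis H_le : forall n t t', H n t = H n t' ->
  forall k, (k <= n)%N -> H k t = H k t'.
Hypothesis M_ge0 : forall n t, 0 <= M n t.
Hypothesis M_adapted : forall n t t', H n t = H n t' -> M n t = M n t'.
Hypothesis M_martingale : forall n (g : T -> R), (forall t, 0 <= g t) ->
  (forall t t', H n t = H n t' -> g t = g t') ->
  (\int[P]_t (g t * M n.+1 t)%:E = \int[P]_t (g t * M n t)%:E)%E.
Hypothesis M_int : (\int[P]_t (M 0%N t)%:E < +oo)%E.

Let mM n : measurable_fun setT (M n).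
Proof. exact: (measurable_fun_fibers (mH n) (@M_adapted n)). Qed.

Lemma martingale_integral n : (\int[P]_t (M n t)%:E = \int[P]_t (M 0%N t)%:E)%E.
Proof.
elim: n => // n <-; have := @M_martingale n (cst 1) (fun=> ler01) (fun _ _ _ => erefl).
by under eq_integral do rewrite mul1r; under [in RHS]eq_integral do rewrite mul1r.
Qed.

Let adapted_upcrossing a b n t t' : H n t = H n t' ->
  upcrossing a b (M ^~ t) n = upcrossing a b (M ^~ t') n.
Proof.
by move=> h; apply: eq_upcrossing => k /(H_le h); exact: M_adapted.
Qed.

(** Doob's inequality. Purchases and sales have the same expectation [S] by the martingale property
    with the flag as weight, and [S] is finite because each [M k] has the integral of [M 0]; so [S]
    cancels. *)
Lemma upcrossing_integral_le (a b : R) n : 0 <= a -> a < b ->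
  (\int[P]_t ((upcrossing a b (M ^~ t) n).2%:R)%:E <= (a / (b - a))%:E)%E.
Proof.
move=> a0 ab; have ba0 : 0 < b - a by rewrite subr_gt0.
pose h k t : R := (upcrossing a b (M ^~ t) k).1%:R.
pose u t : R := (upcrossing a b (M ^~ t) n).2%:R.
have hH k t t' : H k t = H k t' -> h k t = h k t' by move=> /adapted_upcrossing; rewrite /h => ->.
have uH t t' : H n t = H n t' -> u t = u t' by move=> /adapted_upcrossing; rewrite /u => ->.
have mh k : measurable_fun setT (h k) by exact: (measurable_fun_fibers (mH k) (@hH k)).
have mu : measurable_fun setT u by exact: (measurable_fun_fibers (mH n) uH).
have mhM k j : measurable_fun setT (fun t => (h k t * M j t)%:E).
  by apply/measurable_EFinP; exact: measurable_funM.
have hM0 k j t : (0 <= (h k t * M j t)%:E)%E by rewrite lee_fin mulr_ge0.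
pose S := (\sum_(k < n) \int[P]_t (h k t * M k t)%:E)%E.
have Sfin : S \is a fin_num.
  apply: (big_ind (fun x => x \is a fin_num)) => // [x y xf yf|k _].
    by rewrite fin_numD xf.
  rewrite ge0_fin_numE ?integral_ge0//.
  rewrite (le_lt_trans _ M_int)// -(martingale_integral k); apply: ge0_le_integral => //.
  - exact/measurable_EFinP.
  - by move=> t _; rewrite lee_fin ler_piMl// /h lern1 leq_b1.
have : (\int[P]_t (((b - a) * u t)%:E + \sum_(k < n) (h k t * M k t)%:E) <=
        \int[P]_t (a%:E + \sum_(k < n) (h k t * M k.+1 t)%:E))%E.
  apply: ge0_le_integral => //.
  - move=> t _; rewrite adde_ge0 ?sume_ge0// lee_fin mulr_ge0// ltW//.
  - apply: emeasurable_funD; last exact: emeasurable_sum.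
    by apply/measurable_EFinP; exact: measurable_funM.
  - by apply: emeasurable_funD; last exact: emeasurable_sum.
  - move=> t _; rewrite !sumEFin -!EFinD lee_fin; exact: upcrossing_gain.
rewrite ge0_integralD//; last 4 first.
- by move=> t _; rewrite lee_fin mulr_ge0// ltW.
- by apply/measurable_EFinP; exact: measurable_funM.
- by move=> t _; rewrite sume_ge0.
- exact: emeasurable_sum.
rewrite ge0_integralD//; last 2 first.
- by move=> t _; rewrite sume_ge0.
- exact: emeasurable_sum.
rewrite !ge0_integral_sum//.
have -> : (\sum_(k < n) \int[P]_t (h k t * M k.+1 t)%:E = S)%E.
  by apply: eq_bigr => k _; apply: M_martingale => //; exact: hH.
rewrite -/S leeD2rE// integral_cst//.
rewrite [X in (_ <= _ * X)%E -> _](_ : _ = 1%E); last exact: probability_setT.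
rewrite mule1; under eq_integral do rewrite EFinM.
rewrite ge0_integralZl_EFin ?(ltW ba0)//; last 2 first.
- by move=> t _; rewrite lee_fin.
- exact/measurable_EFinP.
by rewrite [(a / (b - a))%:E]EFinM lee_pdivlMr// muleC.
Qed.

Lemma upcrossing_bounded_ae (a b : R) : 0 <= a -> a < b ->
  {ae P, forall t, exists K, forall n, ((upcrossing a b (M ^~ t) n).2 < K)%N}.
Proof.
move=> a0 ab; pose u n t : \bar R := ((upcrossing a b (M ^~ t) n).2%:R)%:E.
have mu n : measurable_fun setT (u n).
  by apply/measurable_EFinP; apply: (measurable_fun_fibers (mH n)) => t t' /adapted_upcrossing ->.
have u0 n t : (0 <= u n t)%E by rewrite lee_fin.
have ndu t : {homo u ^~ t : n k / (n <= k)%N >-> (n <= k)%E}.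
  by move=> n k nk; rewrite lee_fin ler_nat nondecreasing_upcrossing.
have mlim : measurable_fun setT (fun t => limn (u ^~ t)).
  apply: (emeasurable_fun_cvg _ _ mu) => t _; exact: ereal_nondecreasing_is_cvgn.
have lim0 t : (0 <= limn (u ^~ t))%E.
  by apply: lime_ge; [exact: ereal_nondecreasing_is_cvgn|exact: nearW].
have : P.-integrable setT (fun t => limn (u ^~ t)).
  apply/integrableP; split => //.
  under eq_integral do rewrite gee0_abs//.
  rewrite monotone_convergence//.
  apply: (@le_lt_trans _ _ (a / (b - a))%:E); last exact: ltry.
  apply: lime_le.
    by apply: ereal_nondecreasing_is_cvgn => n k nk; apply: ge0_le_integral => // t _; exact: ndu.
  by apply: nearW => n; exact: upcrossing_integral_le.
move=> /(integrable_ae measurableT); apply: filterS => t /(_ I).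
move=> limfin; exists (Num.bound (fine (limn (u ^~ t)))) => n.
have : (u n t <= limn (u ^~ t))%E.
  apply: lime_ge; first exact: ereal_nondecreasing_is_cvgn.
  by exists n => // k /= nk; exact: ndu.
rewrite -(fineK limfin) lee_fin => /le_lt_trans.
move=> /(_ _ (archi_boundP (fine_ge0 (lim0 t)))).
by rewrite ltr_nat.
Qed.

(** Fatou's lemma makes the lower limit finite almost everywhere; the upcrossing bound excludes
    oscillation. *)
Theorem martingale_cvg_ae : {ae P, forall t, cvgn (M ^~ t)}.
Proof.
have inf_ae : {ae P, forall t, (limn_einf (fun n => (M n t)%:E) < +oo)%E}.
  have mMe n : measurable_fun setT (fun t => (M n t)%:E) by exact/measurable_EFinP.
  have minf : measurable_fun setT (fun t => limn_einf (fun n => (M n t)%:E)).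
    apply: (measurableT_comp (f := -%E)) => //.
    by apply: measurable_fun_limn_esup => n; exact: measurableT_comp.
  have inf0 t : (0 <= limn_einf (fun n => (M n t)%:E))%E.
    by apply: (@limn_einf_ge _ (M ^~ t)); exact: nearW.
  have : P.-integrable setT (fun t => limn_einf (fun n => (M n t)%:E)).
    apply/integrableP; split => //.
    under eq_integral do rewrite gee0_abs//.
    apply: (le_lt_trans (fatou _ _ _ _)) => //.
      by move=> n t _; rewrite lee_fin.
    under eq_fun do rewrite martingale_integral.
    by have [-> _] := cvg_limn_einf_sup (@cvg_cst _ (\int[P]_t (M 0%N t)%:E)%E _ \oo _).
  move=> /(integrable_ae measurableT); apply: filterS => t /(_ I).
  by rewrite ge0_fin_numE.
(* Pairs of rational levels are enumerated through [unpickle], which turns the statement into a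
   countable intersection of full events. *)
have upc_ae : {ae P, forall t (i : nat), if unpickle i is Some (qa, qb) then
   0 <= qa :> rat -> qa < qb :> rat ->
   exists K, forall n, ((upcrossing (ratr qa) (ratr qb) (M ^~ t) n).2 < K)%N else True}.
  apply/ae_foralln => i; case: unpickle => [[qa qb]|]; last exact: aeW.
  have [[qa0 qab]|nq] := pselect (0 <= qa /\ qa < qb); last first.
    by apply: aeW => t qa0 qab; exfalso; apply: nq.
  have := @upcrossing_bounded_ae (ratr qa) (ratr qb).
  rewrite ler0q ltr_rat => /(_ qa0 qab); exact: filterS.
apply: filterS2 inf_ae upc_ae => t inft upct.
apply: cvg_bounded_upcrossing => // qa qb qa0 qab.
by have := upct (pickle (qa, qb)); rewrite pickleK; exact.
Qed.

End martingale_convergence.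

Lemma cvg_EFin_comp {R : realType} (u : nat -> R) (l : R) :
  u @ \oo --> l -> (fun n => (u n)%:E) @ \oo --> l%:E.
Proof. by move=> ul; apply: cvg_comp ul _. Qed.

(** * Measurability of pointwise limits *)

Section limit_measurable.
Context {R : realType} {d : measure_display} {T : measurableType d}.

(* Where the sequence diverges, limn takes a constant default value. *)
Lemma measurable_fun_limn (f : nat -> T -> R) : (forall n, measurable_fun setT (f n)) ->
  measurable_fun setT (fun t => limn (f ^~ t)).
Proof.
move=> mf.
pose li t := limn_einf (fun n => (f n t)%:E); pose ls t := limn_esup (fun n => (f n t)%:E).
have mfe n : measurable_fun setT (fun t => (f n t)%:E) by exact/measurable_EFinP.
have mls : measurable_fun setT ls by exact: measurable_fun_limn_esup.
have mli : measurable_fun setT li.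
  apply: (measurableT_comp (f := -%E)) => //.
  by apply: measurable_fun_limn_esup => n; exact: measurableT_comp.
pose C := [set t | cvgn (f ^~ t)].
have CE : C = [set t | li t = ls t] `&` [set t | ls t \is a fin_num].
  apply/seteqP; split => t.
    move=> /cvg_ex[l fl]; have fle : (f n t)%:E @[n --> \oo] --> l%:E by exact: cvg_EFin_comp.
    by have [h1 h2] := cvg_limn_einf_sup fle; split => /=; rewrite /li /ls h2// h1.
  move=> [/= lils lsfin]; apply/cvg_ex; exists (fine (ls t)).
  suff : (fun n => (f n t)%:E) @ \oo --> (fine (ls t))%:E by move=> /fine_cvgP[].
  by rewrite fineK//; exact: limn_einf_esup_cvg.
have mC : measurable C.
  rewrite CE; apply: measurableI.
    by rewrite -[X in measurable X]setTI; exact: measurable_eqe.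
  by rewrite -[X in measurable X]setTI; exact: emeasurable_fin_num.
have -> : (fun t => limn (f ^~ t)) = (fine \o ls) \_ C.
  apply/funext => t; rewrite patchE; case: ifPn => [|]; rewrite ?inE ?notin_setE.
    move=> cft; rewrite /= /ls.
    have fle : (f n t)%:E @[n --> \oo] --> (limn (f ^~ t))%:E by exact: cvg_EFin_comp.
    by have [_ ->] := cvg_limn_einf_sup fle.
  move=> nC; rewrite /lim /lim_in /get; apply: (xgetPN point) => l fl.
  by apply: nC; apply/cvg_ex; exists l.
apply: (measurable_restrictT _ mC).1; apply: measurable_funTS.
exact: (measurableT_comp (fine_measurable measurableT) mls).
Qed.

End limit_measurable.

(** * The limit of [Z_n / m^n] and its Laplace transform *)

Section galton_watson_limit.
Context {R : realType} {d : measure_display} {T : measurableType d}.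
Variables (P : probability T R) (p : nat -> R) (m : R) (mu : nat).
Variables (xi : nat -> nat -> T -> nat) (X : nat -> T -> R).
Hypotheses (p_ge0 : forall k, 0 <= p k) (p_sum : series p @ \oo --> (1 : R)).
Hypothesis p_mean : series (fun k => k%:R * p k) @ \oo --> m.
Hypothesis m_gt1 : 1 < m.
Hypotheses (p_mu : 0 < p mu) (p_lt_mu : forall k, (k < mu)%N -> p k = 0).
Hypothesis mxi : forall n i, measurable_fun setT (fun t => (xi n i t)%:R : R).
Hypothesis xip : forall n i k, P [set t | xi n i t = k] = (p k)%:E.
Hypothesis mX : forall i, measurable_fun setT (X i).
Hypothesis iY : mutually_independent P
    (fun j : (nat * nat) + nat =>
       match j with inl (n, i) => fun t => (xi n i t)%:R | inr i => X i end).
Notation Z := (GW xi).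

Let m_gt0 : 0 < m. Proof. exact: lt_trans m_gt1. Qed.

Lemma GW_cvg_ae : {ae P, forall t, cvgn (fun n => (Z n t)%:R / m ^+ n)}.
Proof.
apply: (@martingale_cvg_ae _ _ _ P (hist xi) (fun n t => (Z n t)%:R / m ^+ n)).
- exact: measurable_hist mxi mX iY.
- by move=> n t t' h k; exact: hist_le.
- by move=> n t; rewrite divr_ge0// exprn_ge0// ltW.
- by move=> n t t' /histP ->.
- move=> n g g0 gh.
  transitivity (\int[P]_t ((g t / m ^+ n.+1) * (Z n.+1 t)%:R)%:E)%E.
    by apply: eq_integral => t _; rewrite mulrAC mulrA.
  rewrite (integral_GW_martingale mxi xip mX iY p_ge0 p_mean).
  + apply: eq_integral => t _; congr EFin; rewrite exprS invfM.
    by field; rewrite ?expf_neq0 ?gt_eqF.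
  + by move=> t; rewrite divr_ge0// exprn_ge0// ltW.
  + by move=> t t' /gh ->.
- rewrite (eq_integral (cst 1%:E)); last by move=> t _; rewrite /= expr0 divr1.
  rewrite integral_cst// mul1e; rewrite [X in (X < _)%E](_ : _ = 1%E) ?ltry//.
  exact: probability_setT.
Qed.

(** The left side is the expectation of [exp(- h Z_n / m^n)], dominated by [1]. The value of [Wlim]
    where the sequence diverges is irrelevant, that set being null. *)
Lemma cvg_phiW h : 0 <= h ->
  (fun n => pgf_iter p n (expR (- (h / m ^+ n)))) @ \oo --> phiW P xi m h.
Proof.
move=> h0.
have mM n : measurable_fun setT (fun t => (Z n t)%:R / m ^+ n : R).
  exact: (measurable_fun_GW mxi mX iY n (fun z => z%:R / m ^+ n : R)).
have me (g : T -> R) : measurable_fun setT g ->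
    measurable_fun setT (fun t => (expR (- h * g t))%:E).
  move=> mg; apply/measurable_EFinP; apply: measurableT_comp => //; exact: measurable_funM.
have ae_cvg : {ae P, forall t, setT t ->
    (expR (- h * ((Z n t)%:R / m ^+ n)))%:E @[n --> \oo] --> (expR (- h * Wlim xi m t))%:E}.
  apply: filterS GW_cvg_ae => t ct _; apply: cvg_EFin_comp.
  by apply: continuous_cvg; [exact: continuous_expR|exact: cvgMl_tmp].
have int1 : P.-integrable setT (cst (1 : R)%:E).
  exact: finite_measure_integrable_cst.
have bound1 : {ae P, forall t n, setT t ->
    (`|(expR (- h * ((Z n t)%:R / m ^+ n)))%:E| <= cst (1 : R)%:E t)%E}.
  apply: aeW => t n _; rewrite gee0_abs ?lee_fin ?expR_ge0// expR_le1.
  by rewrite mulNr oppr_le0 mulr_ge0// divr_ge0// exprn_ge0// ltW.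
have [intW _ ] := dominated_convergence measurableT
  (fun n => me _ (mM n)) (me _ (measurable_fun_limn mM)) ae_cvg int1 bound1.
move=> cvgI; have : (pgf_iter p n (expR (- (h / m ^+ n))))%:E @[n --> \oo] -->
    (\int[P]_t (expR (- h * Wlim xi m t))%:E)%E.
  apply: cvg_trans cvgI; apply: near_eq_cvg; apply: nearW => n /=.
  have hm0 : 0 <= h / m ^+ n by rewrite divr_ge0// exprn_ge0// ltW.
  rewrite -(integral_GW_pgf mxi xip mX iY p_ge0 p_sum p_mu p_lt_mu).
    by apply: eq_integral => t _; rewrite -expRM_natl; congr (expR _)%:E; ring.
  by rewrite expR_gt0 expR_le1 oppr_le0.
by rewrite -(fineK (integrable_fin_num measurableT intW)) => /fine_cvgP[].
Qed.

(** Positivity comes from [E exp(- h Z_n / m^n) >= exp(- h)] for every [n]. *)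
Lemma phiW_itv h : 0 <= h -> 0 < phiW P xi m h <= 1.
Proof.
move=> h0; have cp := cvg_phiW h0; rewrite -(cvg_lim (@Rhausdorff R) cp).
have hm0 n : 0 <= h / m ^+ n by rewrite divr_ge0// exprn_ge0// ltW.
have s01 n : 0 < expR (- (h / m ^+ n)) <= 1 by rewrite expR_gt0 expR_le1 oppr_le0 hm0.
have ccp : cvgn (fun n => pgf_iter p n (expR (- (h / m ^+ n)))).
  by apply/cvg_ex; eexists; exact: cp.
apply/andP; split.
  apply: (@lt_le_trans _ _ (expR (- h))); first exact: expR_gt0.
  apply: limr_ge => //; apply: nearW => n.
  have := pgf_iter_expR_ge p_ge0 p_sum p_mean p_mu p_lt_mu n (hm0 n) (ltW m_gt0).
  by rewrite mulrCA mulfV ?mulr1// expf_neq0// gt_eqF.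
apply: limr_le => //; apply: nearW => n.
by have /andP[] := pgf_iter_itv p_ge0 p_sum p_mu p_lt_mu n (s01 n).
Qed.

End galton_watson_limit.

(** * Exponential moments and Chernoff bounds *)

Section mgf.
Context {R : realType} {d : measure_display} {T : measurableType d}.
Variables (P : probability T R) (X : T -> R) (h : R).
Hypothesis mX : measurable_fun setT X.
Hypothesis iX : P.-integrable setT (EFin \o X).
Hypothesis X0 : (\int[P]_t (X t)%:E = 0)%E.
Hypothesis X2 : (0 < \int[P]_t ((X t) ^+ 2)%:E < +oo)%E.
Hypothesis h_gt0 : 0 < h.
Hypothesis Xh : (\int[P]_t (expR (h * `|X t|))%:E < +oo)%E.
Notation v := (variance0 P X).

Lemma variance0_gt0 : 0 < v.
Proof. by rewrite /variance0 fine_gt0. Qed.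

(** The remainder series starts at the third term, and [(3 + k)! >= k!] compares it with [|x|^3]
    times the series of [exp |x|]. *)
Lemma expR_taylor2 (x : R) : `|expR x - (1 + x + x ^+ 2 / 2)| <= `|x| ^+ 3 * expR `|x|.
Proof.
have cvge (y : R) : series (exp_coeff y) @ \oo --> expR y.
  exact: is_cvg_series_exp_coeff.
have c3 : (fun n => `|series (exp_coeff x) (n + 3)%N - (1 + x + x ^+ 2 / 2)|) @ \oo -->
    `|expR x - (1 + x + x ^+ 2 / 2)|.
  apply: cvg_norm; apply: cvgB; last exact: cvg_cst.
  by rewrite cvg_shiftn; exact: cvge.
rewrite -(cvg_lim (@Rhausdorff R) c3).
apply: limr_le; first by apply/cvg_ex; eexists; exact: c3.
apply: nearW => n.
have -> : series (exp_coeff x) (n + 3)%N - (1 + x + x ^+ 2 / 2) =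
    \sum_(k < n) exp_coeff x (3 + k)%N.
  rewrite /series /= addnC big_mkord big_split_ord /= !big_ord_recl big_ord0 /=.
  rewrite /bump /= /exp_coeff /= expr0 expr1 (_ : 2`!%:R = 2 :> R)// addr0.
  by rewrite !divr1; ring.
apply: (le_trans (ler_norm_sum _ _ _)).
apply: (@le_trans _ _ (`|x| ^+ 3 * series (exp_coeff `|x|) n)); last first.
  rewrite ler_wpM2l// ?exprn_ge0// -(cvg_lim (@Rhausdorff R) (cvge `|x|)).
  apply: nondecreasing_cvgn_le; last by apply/cvg_ex; eexists; exact: cvge.
  by apply: nondecreasing_series => k _ _; exact: exp_coeff_ge0.
rewrite /series /= big_mkord mulr_sumr; apply: ler_sum => k _.
rewrite /exp_coeff /= normrM normrX exprD -mulrA ler_wpM2l ?exprn_ge0//.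
rewrite normfV normr_nat ler_wpM2l ?exprn_ge0//.
by rewrite lef_pV2 ?posrE ?ltr0n ?fact_gt0// ler_nat leq_fact// leq_addl.
Qed.

Let integrable_expR (th : R) : `|th| <= h ->
  P.-integrable setT (EFin \o (fun t => expR (th * X t))).
Proof.
move=> thh; apply: (le_integrable measurableT _ _ (g := EFin \o (fun t => expR (h * `|X t|)))).
- apply/measurable_EFinP; apply: measurableT_comp => //; exact: measurable_funM.
- move=> t _ /=; rewrite lee_fin !(ger0_norm (expR_ge0 _)) ler_expR.
  by rewrite (le_trans (ler_norm _))// normrM ler_wpM2r.
- apply/integrableP; split.
    apply/measurable_EFinP; apply: measurableT_comp => //; apply: measurable_funM => //.
    exact: measurableT_comp.
  by under eq_integral do rewrite /= (ger0_norm (expR_ge0 _)).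
Qed.

Lemma mgf_taylor : exists C : R, 0 <= C /\ forall th, `|th| <= h / 2 -> exists M,
  (\int[P]_t (expR (th * X t))%:E = M%:E)%E /\
  `|M - (1 + th ^+ 2 * v / 2)| <= C * `|th| ^+ 3.
Proof.
have h0 : 0 <= h by exact: ltW.
pose E := Rintegral P setT (fun t => expR (h * `|X t|)).
have iE : P.-integrable setT (EFin \o (fun t => expR (h * `|X t|))).
  apply/integrableP; split.
    apply/measurable_EFinP; apply: measurableT_comp => //; apply: measurable_funM => //.
    exact: measurableT_comp.
  by under eq_integral do rewrite /= (ger0_norm (expR_ge0 _)).
have iX2 : P.-integrable setT (EFin \o (fun t => X t ^+ 2)).
  apply/integrableP; split; first by apply/measurable_EFinP; exact: measurable_funX.
  by under eq_integral do rewrite /= (ger0_norm (sqr_ge0 _)); case/andP: X2.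
have i1 : P.-integrable setT (EFin \o (fun=> 1 : R)).
  exact: finite_measure_integrable_cst.
(* With [z = h |X| / 2], [|X|^3 = (48 / h^3) (z^3 / 6) <= (48 / h^3) e^z]. A second factor [e^z]
   bounds [exp(|th| |X|)], and [e^z e^z = exp(h |X|)]. *)
exists (48 / h ^+ 3 * E); split.
  rewrite mulr_ge0 ?divr_ge0 ?exprn_ge0//; apply: Rintegral_ge0 => t _; exact: expR_ge0.
move=> th thh; have thh' : `|th| <= h by rewrite (le_trans thh)// ler_pdivrMr// ler_peMr// ler1n.
have ie := integrable_expR thh'.
exists (Rintegral P setT (fun t => expR (th * X t))); split.
  by rewrite /Rintegral fineK//; exact: (integrable_fin_num measurableT ie).
pose q t := 1 + (th * X t + th ^+ 2 / 2 * X t ^+ 2).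
have iZ (c : R) f : P.-integrable setT (EFin \o f) ->
    P.-integrable setT (EFin \o (fun t => c * f t)).
  by move=> /(integrableZl measurableT c); apply: eq_integrable => // t _ /=; rewrite EFinM.
have iD f g : P.-integrable setT (EFin \o f) -> P.-integrable setT (EFin \o g) ->
    P.-integrable setT (EFin \o (fun t => f t + g t)).
  move=> If Ig; have := integrableD measurableT If Ig.
  by apply: eq_integrable => // t _ /=; rewrite EFinD.
have iq : P.-integrable setT (EFin \o q) by apply: (iD) => //; apply: (iD); exact: iZ.
have qE : Rintegral P setT q = 1 + th ^+ 2 * v / 2.
  rewrite /q RintegralD//; last by apply: (iD); exact: iZ.
  rewrite RintegralD//; [|exact: iZ|exact: iZ].
  rewrite RintegralZl// RintegralZl// {2}/Rintegral X0 /= mulr0 add0r.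
  rewrite [X in X + _](_ : _ = 1); first by rewrite -/v mulrAC.
  rewrite Rintegral_cst// mul1r [X in fine X](_ : _ = 1%E)//; exact: probability_setT.
rewrite -qE -RintegralB//.
have ir : P.-integrable setT (EFin \o (fun t => expR (th * X t) - q t)).
  by have := integrableB measurableT ie iq; apply: eq_integrable => // t _ /=; rewrite EFinB.
rewrite (le_trans (le_normr_Rintegral measurableT ir))//.
rewrite mulrAC -RintegralZl//; apply: le_Rintegral => //; last 2 first.
- exact: iZ.
- move=> t _.
  have := expR_taylor2 (th * X t).
  rewrite (_ : 1 + th * X t + _ = q t); last by rewrite /q exprMn -addrA; congr (_ + (_ + _)); ring.
  move=> /le_trans; apply.
  rewrite normrM exprMn -mulrA.
  rewrite [leRHS](_ : _ = `|th| ^+ 3 * (48 / h ^+ 3 * expR (h * `|X t|))); last by ring.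
  rewrite ler_wpM2l ?exprn_ge0//.
  pose z := h / 2 * `|X t|.
  have z0 : 0 <= z by rewrite mulr_ge0// divr_ge0.
  have ez := expR_ge1Dxn 2 z0.
  have -> : h * `|X t| = z + z by rewrite /z; field.
  rewrite expRD.
  have ethz : expR (`|th| * `|X t|) <= expR z by rewrite ler_expR ler_wpM2r.
  have X3 : `|X t| ^+ 3 <= 48 / h ^+ 3 * expR z.
    have -> : `|X t| ^+ 3 = 48 / h ^+ 3 * (z ^+ 3 / 6).
      by rewrite /z; field; rewrite gt_eqF.
    rewrite ler_wpM2l ?divr_ge0 ?exprn_ge0//.
    by move: ez; rewrite (_ : 3`!%:R = 6 :> R)//; lra.
  by rewrite mulrA ler_pM ?exprn_ge0 ?expR_ge0.
- exact: (integrable_norm ir).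
Qed.

Lemma mgf_bounds (k : R) : 0 < k < 1 -> exists th0, 0 < th0 /\ forall th, `|th| <= th0 -> exists M,
  (\int[P]_t (expR (th * X t))%:E = M%:E)%E /\
  expR ((1 - k) * (v * th ^+ 2 / 2)) <= M <= expR ((1 + k) * (v * th ^+ 2 / 2)).
Proof.
move=> /andP[k0 k1]; have v0 := variance0_gt0.
have [C [C0 CP]] := mgf_taylor.
(* In order: validity of the expansion, cubic error at most [k / 2] times [y = v th^2 / 2], and,
   from the last two, [y <= k / 2]. *)
pose th0 := Num.min (h / 2) (Num.min (k * v / 4 / (C + 1)) (Num.min 1 (k / v))).
have th00 : 0 < th0 by rewrite !lt_min ltr01 !divr_gt0// ?mulr_gt0// ltr_wpDl.
exists th0; split => // th; rewrite !le_min => /and4P[th_h th_C th_1 th_v].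
have [M [ME MP]] := CP th th_h; exists M; split => //.
have n0 := normr_ge0 th; have th2 : th ^+ 2 = `|th| ^+ 2 by rewrite real_normK ?num_real.
have Cth : C * `|th| <= k * v / 4.
  by move: th_C; rewrite ler_pdivlMr ?ltr_wpDl//; nra.
pose y := v * th ^+ 2 / 2.
have y0 : 0 <= y by rewrite /y th2; nra.
have C3 : C * `|th| ^+ 3 <= k / 2 * y.
  by rewrite /y th2 exprS; have := ler_wpM2r (exprn_ge0 2 n0) Cth; lra.
have yk : y <= k / 2.
  move: th_v; rewrite ler_pdivlMr// /y th2 => th_v; nra.
move: MP; rewrite (_ : th ^+ 2 * v / 2 = y); last by rewrite /y [v * _]mulrC.
rewrite ler_norml => /andP[M1 M2]; apply/andP; split; last first.
  by have := expR_ge1Dx ((1 + k) * y); nra.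
(* The lower bound needs a converse to [1 + x <= e^x]: here [1 + x >= exp(x / (1 + x))], and
   [x <= k / 2] gives [x / (1 + x) >= (1 - k) y]. *)
pose x := y - k / 2 * y.
have x0 : 0 <= x by rewrite /x; nra.
have Mx : 1 + x <= M by rewrite /x; lra.
have ex : expR (x / (1 + x)) <= 1 + x.
  have := expR_ge1Dx (- (x / (1 + x))).
  rewrite expRN (_ : 1 + - (x / (1 + x)) = (1 + x)^-1); last by field; lra.
  by rewrite lef_pV2 ?posrE ?expR_gt0// ltr_wpDr.
rewrite (le_trans _ Mx)// (le_trans _ ex)// ler_expR ler_pdivlMr ?ltr_wpDr//.
have xk : x <= k / 2 by rewrite /x; nra.
have kx : (1 - k) * (1 + x) <= 1 - k / 2 by nra.
by have := ler_wpM2r y0 kx; rewrite /x -/y; lra.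
Qed.

End mgf.

(** * Two-sided Chernoff bounds on an event [D] *)

Section chernoff.
Context {R : realType} {d : measure_display} {T : measurableType d}.
Variables (P : {measure set T -> \bar R}) (D : set T) (S : T -> R) (k : nat).
Variables (pd v kappa th0 : R).
Hypotheses (mD : measurable D) (mS : measurable_fun setT S) (PD : P D = pd%:E).
Hypothesis v_gt0 : 0 < v.
Hypothesis mgfS : forall th, `|th| <= th0 -> exists M,
  (\int[P]_(t in D) (expR (th * S t))%:E = (pd * M ^+ k)%:E)%E /\
  expR ((1 - kappa) * (v * th ^+ 2 / 2)) <= M <= expR ((1 + kappa) * (v * th ^+ 2 / 2)).

Let pd_ge0 : 0 <= pd. Proof. by rewrite -lee_fin -PD. Qed.

Let tail x := [set t | x <= S t].

Let mtail x : measurable (tail x).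
Proof.
rewrite (_ : tail x = S @^-1` `[x, +oo[%classic); first exact: measurable_preimage.
by apply/seteqP; split => t /=; rewrite in_itv /= andbT.
Qed.

Let mexp th : measurable_fun D (fun t => (expR (th * S t))%:E).
Proof.
apply/measurable_EFinP; apply: measurable_funTS; apply: measurableT_comp => //.
exact: measurable_funM.
Qed.

Let tailE x : (P (D `&` tail x) = \int[P]_(t in D) (\1_(tail x) t)%:E)%E.
Proof. by rewrite integral_indic// setIC. Qed.

(** Exponential Markov inequality at [th = eps / v], the minimiser of [v th^2 / 2 - eps th]. *)
Lemma chernoff_upper (eps : R) : 0 < eps -> eps / v <= th0 ->
  (P (D `&` [set t | (eps * k%:R <= S t)%R]) <=
   (pd * expR (- ((1 - kappa) * (k%:R * (eps ^+ 2 / (2 * v))))))%:E)%E.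
Proof.
move=> e0 eth; have th_ge0 : 0 <= eps / v by rewrite divr_ge0// ltW.
have [|M [ME /andP[M1 M2]]] := mgfS (th := eps / v); first by rewrite ger0_norm.
have M0 : 0 <= M by rewrite (le_trans _ M1)// expR_ge0.
rewrite -/(tail _) tailE.
apply: (@le_trans _ _ (\int[P]_(t in D)
    ((expR (- (eps / v * (eps * k%:R))))%:E * (expR (eps / v * S t))%:E))%E).
  apply: ge0_le_integral => //.
  - by apply/measurable_EFinP; apply: measurable_funTS; exact/measurable_indicP.
  - exact: emeasurable_funM.
  - move=> t _; rewrite -EFinM lee_fin -expRD indicE.
    case: (boolP (t \in _)) => [|_]; last exact: expR_ge0.
    by rewrite inE /tail /= => St; rewrite -[leLHS]expR0 ler_expR addrC subr_ge0 ler_wpM2l.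
rewrite ge0_integralZl_EFin ?expR_ge0//.
rewrite ME -EFinM lee_fin mulrCA ler_wpM2l//.
apply: (@le_trans _ _ (expR (- (eps / v * (eps * k%:R))) *
    expR (k%:R * ((1 + kappa) * (v * (eps / v) ^+ 2 / 2))))).
  by rewrite ler_wpM2l ?expR_ge0// expRM_natl lerXn2r// nnegrE expR_ge0.
rewrite -expRD ler_expR le_eqVlt; apply/orP; left; apply/eqP; field.
by rewrite gt_eqF.
Qed.

(* Tilting by [th = (1 + eta) eps / v] centres [S / k] at [(1 + eta) eps]; a second
   tilt by [-+ ta] shows that [S < eps k] and [S > (1 + 2 eta) eps k] each contribute
   at most a quarter of [E exp(th S)]. *)
Lemma chernoff_lower (eta eps : R) : 0 < eta <= 1 -> kappa = eta ^+ 2 / 26 ->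
  0 < eps -> (1 + 2 * eta) * (eps / v) <= th0 -> 8 * v / eta ^+ 2 <= k%:R * eps ^+ 2 ->
  ((pd / 2 * expR (- ((1 + 8 * eta) * (k%:R * (eps ^+ 2 / (2 * v))))))%:E <=
   P (D `&` [set t | (eps * k%:R <= S t)%R]))%E.
Proof.
move=> /andP[eta0 eta1] kE e0 eth kK.
have ev0 : 0 < eps / v by rewrite divr_gt0.
pose th := (1 + eta) * (eps / v); pose ta := eta * (eps / v).
have [|M0 [ME0 /andP[M01 _]]] := mgfS (th := th).
  by rewrite /th ger0_norm; nra.
have [|M1 [ME1 /andP[M11 M12]]] := mgfS (th := th - ta).
  by rewrite /th /ta ger0_norm; nra.
have [|M2 [ME2 /andP[M21 M22]]] := mgfS (th := th + ta).
  by rewrite /th /ta ger0_norm; nra.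
pose B := k%:R * (eps ^+ 2 / (2 * v)).
(* The threshold [8 v / eta^2] is chosen for this: a margin [eta^2 / 2] in the coefficient of [B]
   then yields [2] in the exponent, and [e^(-2) <= 1/4]. *)
have B4 : 4 <= B * eta ^+ 2.
  move: kK; rewrite ler_pdivrMr ?exprn_gt0// => kK.
  have -> : B * eta ^+ 2 = k%:R * eps ^+ 2 * eta ^+ 2 / (2 * v).
    by rewrite /B; field; rewrite gt_eqF.
  by rewrite ler_pdivlMr ?mulr_gt0//; lra.
have B0 : 0 < B by rewrite -(pmulr_lgt0 _ (exprn_gt0 2 eta0)); lra.
rewrite -/(tail _) -/B.
have Pfin : P (D `&` tail (eps * k%:R)) \is a fin_num.
  have le_PD : (P (D `&` tail (eps * k%:R)%R) <= P D)%E.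
    by apply: le_measure; rewrite ?inE//; exact: measurableI.
  by rewrite ge0_fin_numE// (le_lt_trans le_PD)// PD ltry.
set q := P _ in Pfin *; rewrite -(fineK Pfin) lee_fin.
have key : pd * M0 ^+ k <= expR (th * (eps * (1 + 2 * eta) * k%:R)) * fine q +
   (expR (ta * (eps * k%:R)) * (pd * M1 ^+ k) +
    expR (- (ta * (eps * (1 + 2 * eta) * k%:R))) * (pd * M2 ^+ k)).
  suff : ((pd * M0 ^+ k)%:E <= (expR (th * (eps * (1 + 2 * eta) * k%:R)))%:E * q +
      ((expR (ta * (eps * k%:R)))%:E * (pd * M1 ^+ k)%:E +
       (expR (- (ta * (eps * (1 + 2 * eta) * k%:R))))%:E * (pd * M2 ^+ k)%:E))%E.
    by rewrite -(fineK Pfin) -!EFinM -!EFinD lee_fin.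
  rewrite -ME0 -ME1 -ME2 /q tailE.
  have mi : measurable_fun D (fun t => (\1_(tail (eps * k%:R)) t : R)%:E).
    by apply/measurable_EFinP; apply: measurable_funTS; exact/measurable_indicP.
  have eT th' t : D t -> (0 <= (expR (th' * S t))%:E)%E by move=> _; rewrite lee_fin expR_ge0.
  have iT t : D t -> (0 <= (\1_(tail (eps * k%:R)) t : R)%:E)%E by move=> _; rewrite lee_fin.
  have mc (c : R) (f : T -> \bar R) : measurable_fun D f ->
      measurable_fun D (fun t => (c%:E * f t)%E).
    by move=> mf; exact: emeasurable_funM.
  rewrite -[(_ * \int[P]_(t in D) (\1__ t)%:E)%E]ge0_integralZl_EFin ?expR_ge0//.
  rewrite -[(_ * \int[P]_(t in D) (expR ((th - ta) * _))%:E)%E]ge0_integralZl_EFin ?expR_ge0//.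
  rewrite -[(_ * \int[P]_(t in D) (expR ((th + ta) * _))%:E)%E]ge0_integralZl_EFin ?expR_ge0//.
  have cE c th' t : D t -> (0 <= (expR c)%:E * (expR (th' * S t))%:E)%E.
    by move=> _; rewrite mule_ge0 ?lee_fin ?expR_ge0.
  rewrite -[(\int[P]_(t in D) _ +
    \int[P]_(t in D) (_ * (expR ((th + ta) * _))%:E))%E]ge0_integralD//;
    try exact: mc; try exact: cE.
  rewrite -ge0_integralD//; try exact: mc; last 2 first.
  - by move=> t Dt; apply: adde_ge0; exact: cE.
  - by apply: emeasurable_funD; exact: mc.
  apply: ge0_le_integral => //.
  - by apply: emeasurable_funD; [exact: mc|apply: emeasurable_funD; exact: mc].
  move=> t _; rewrite -!EFinM -!EFinD lee_fin -!expRD.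
  have th00 : 0 <= th by rewrite /th; nra.
  have ta00 : 0 <= ta by rewrite /ta; nra.
  set u := S t; have [ut|ut] := leP (eps * k%:R) u.
    have -> : \1_(tail (eps * k%:R)) t = 1 :> R by rewrite indicE mem_set.
    have [ut2|ut2] := leP u (eps * (1 + 2 * eta) * k%:R).
      rewrite mulr1 -[leLHS]addr0 lerD ?addr_ge0 ?expR_ge0// ler_expR ler_wpM2l//.
    rewrite addrA -[leLHS]add0r lerD ?addr_ge0 ?mulr_ge0 ?expR_ge0// ler_expR.
    by have := ler_wpM2l ta00 (ltW ut2); lra.
  rewrite addrCA -[leLHS]addr0 lerD ?addr_ge0 ?mulr_ge0 ?expR_ge0//.
  by rewrite ler_expR; have := ler_wpM2l ta00 (ltW ut); lra.
have e2 : expR (- 2) <= 1 / 4 :> R.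
  rewrite expRN div1r lef_pV2 ?posrE ?expR_gt0//.
  have := expR_ge1Dx (1 : R); rewrite (_ : 2 = 1 + 1)// expRD; nra.
have M0_ge0 : 0 <= M0 by rewrite (le_trans _ M01)// expR_ge0.
pose b := (1 - kappa) * (1 + eta) ^+ 2 * B.
have E0 : expR b <= M0 ^+ k.
  rewrite (_ : b = k%:R * ((1 - kappa) * (v * th ^+ 2 / 2))); last first.
    by rewrite /b /B /th; field; rewrite gt_eqF.
  by rewrite expRM_natl lerXn2r// nnegrE expR_ge0.
have quarter x : x <= b - 2 -> expR x <= M0 ^+ k / 4.
  move=> xb; rewrite (@le_trans _ _ (expR b * expR (- 2)))//.
    by rewrite -expRD ler_expR.
  rewrite (@le_trans _ _ (expR b * (1 / 4)))// ?ler_wpM2l ?expR_ge0//; lra.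
have le1 : 1 + kappa + 2 * eta <= (1 - kappa) * (1 + eta) ^+ 2 - eta ^+ 2 / 2.
  have : 0 <= eta ^+ 2 * (11 - 2 * eta - eta ^+ 2) by rewrite mulr_ge0 ?sqr_ge0//; nra.
  by rewrite kE; lra.
(* At [eta = 1] this is an equality, since [26 = 2 (2 + 6 + 5)]; this determines the constant in
   [kappa]. *)
have le2 : 1 + 2 * eta + kappa * (1 + 2 * eta) ^+ 2 <=
    (1 - kappa) * (1 + eta) ^+ 2 - eta ^+ 2 / 2.
  have : 0 <= eta ^+ 2 * (11 - 6 * eta - 5 * eta ^+ 2) by rewrite mulr_ge0 ?sqr_ge0//; nra.
  by rewrite kE; lra.
have E1 : expR (ta * (eps * k%:R)) * M1 ^+ k <= M0 ^+ k / 4.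
  rewrite (le_trans _ (quarter ((1 + kappa + 2 * eta) * B) _))//; last first.
    by rewrite /b; have := ler_wpM2r (ltW B0) le1; lra.
  rewrite (_ : (1 + kappa + 2 * eta) * B = ta * (eps * k%:R) +
      k%:R * ((1 + kappa) * (v * (th - ta) ^+ 2 / 2))); last first.
    by rewrite /B /th /ta; field; rewrite gt_eqF.
  rewrite expRD ler_wpM2l ?expR_ge0// expRM_natl lerXn2r// nnegrE ?expR_ge0//.
  by rewrite (le_trans _ M11)// expR_ge0.
have E2 : expR (- (ta * (eps * (1 + 2 * eta) * k%:R))) * M2 ^+ k <= M0 ^+ k / 4.
  rewrite (le_trans _ (quarter ((1 + 2 * eta + kappa * (1 + 2 * eta) ^+ 2) * B) _))//; last first.
    by rewrite /b; have := ler_wpM2r (ltW B0) le2; lra.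
  rewrite (_ : (1 + 2 * eta + kappa * (1 + 2 * eta) ^+ 2) * B =
      - (ta * (eps * (1 + 2 * eta) * k%:R)) +
      k%:R * ((1 + kappa) * (v * (th + ta) ^+ 2 / 2))); last first.
    by rewrite /B /th /ta; field; rewrite gt_eqF.
  rewrite expRD ler_wpM2l ?expR_ge0// expRM_natl lerXn2r// nnegrE ?expR_ge0//.
  by rewrite (le_trans _ M21)// expR_ge0.
pose w := th * (eps * (1 + 2 * eta) * k%:R).
have half : pd / 2 * M0 ^+ k <= expR w * fine q.
  have := ler_wpM2l pd_ge0 E1; have := ler_wpM2l pd_ge0 E2; move: key; rewrite -/w.
  rewrite [expR (ta * _) * (pd * _)]mulrCA [expR (- _) * (pd * _)]mulrCA.
  lra.
have -> : fine q = expR (- w) * (expR w * fine q) by rewrite mulrA -expRD addNr expR0 mul1r.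
apply: le_trans (ler_wpM2l (expR_ge0 (- w)) half).
rewrite [leRHS]mulrCA ler_wpM2l ?divr_ge0//.
apply: le_trans (ler_wpM2l (expR_ge0 (- w)) E0); rewrite -expRD ler_expR.
have -> : w = 2 * (1 + eta) * (1 + 2 * eta) * B.
  by rewrite /w /B /th; field; rewrite gt_eqF.
(* The total cost is [1 + 4 eta + 3 eta^2 + kappa (1 + eta)^2], at most [1 + 8 eta] because
   [eta <= 1]. *)
rewrite /b kE -!mulNr -mulrDl ler_wpM2r ?(ltW B0)//; nra.
Qed.

(* When [k eps^2] is too small for [chernoff_lower], the deviation is enlarged to
   [e'] with [k e'^2 = 8 v / eta^2], at the price of a constant factor. *)
Lemma chernoff_lower_uniform (eta eps : R) : 0 < eta <= 1 -> kappa = eta ^+ 2 / 26 ->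
  0 < th0 -> 0 < eps -> (1 + 2 * eta) * (eps / v) <= th0 ->
  8 * v / eta ^+ 2 / (th0 * v / (1 + 2 * eta)) ^+ 2 <= k%:R ->
  ((expR (- ((1 + 8 * eta) * (4 / eta ^+ 2))) / 2 *
    (pd * expR (- ((1 + 8 * eta) * (k%:R * (eps ^+ 2 / (2 * v)))))))%:E <=
   P (D `&` [set t | (eps * k%:R <= S t)%R]))%E.
Proof.
move=> eta01 kE th00 e0 eth kK; have /andP[eta0 eta1] := eta01.
pose K := 8 * v / eta ^+ 2.
have K0 : 0 < K by rewrite !divr_gt0 ?mulr_gt0 ?exprn_gt0.
have eta80 : 0 <= 1 + 8 * eta by nra.
have x1 (x : R) : 0 <= x -> expR (- x) <= 1 by move=> x0; rewrite expR_le1 oppr_le0.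
have [kb|kb] := leP K (k%:R * eps ^+ 2).
  apply: le_trans (chernoff_lower eta01 kE e0 eth kb).
  rewrite lee_fin; set F := expR (- ((1 + 8 * eta) * (k%:R * _))).
  have c1 : expR (- ((1 + 8 * eta) * (4 / eta ^+ 2))) <= 1.
    by rewrite x1// mulr_ge0// divr_ge0// exprn_ge0// ltW.
  have pF : 0 <= pd * F by rewrite mulr_ge0 ?expR_ge0.
  by have := ler_wpM2r pF c1; lra.
(* The largest deviation whose tilts stay within [th0]. The lower bound on [k] says exactly that
   [e'] does not exceed it. *)
pose e0' := th0 * v / (1 + 2 * eta).
have e0'0 : 0 < e0' by rewrite divr_gt0 ?mulr_gt0//; nra.
have k0 : 0 < k%:R :> R by rewrite (lt_le_trans _ kK)// divr_gt0// exprn_gt0.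
pose e' := Num.sqrt (K / k%:R).
have e'2 : e' ^+ 2 = K / k%:R by rewrite sqr_sqrtr// divr_ge0// ltW.
have e'0 : 0 < e' by rewrite sqrtr_gt0 divr_gt0.
have ee' : eps <= e'.
  rewrite -(@ler_pXn2r _ 2) ?nnegrE ?(ltW e0) ?(ltW e'0)// e'2 ler_pdivlMr// mulrC.
  exact: ltW.
have e'e0 : e' <= e0'.
  rewrite -(@ler_pXn2r _ 2) ?nnegrE ?(ltW e'0) ?(ltW e0'0)// e'2 ler_pdivrMr//.
  by move: kK; rewrite -/K -/e0' ler_pdivrMr ?exprn_gt0// mulrC.
have kE' : k%:R * e' ^+ 2 = K by rewrite e'2 mulrC divfK// gt_eqF.
have eth' : (1 + 2 * eta) * (e' / v) <= th0.
  have : (1 + 2 * eta) * (e0' / v) <= th0.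
    rewrite /e0' le_eqVlt; apply/orP; left; apply/eqP; field.
    by rewrite gt_eqF//= gt_eqF//; nra.
  apply: le_trans; rewrite ler_wpM2l//; first nra.
  by rewrite ler_wpM2r// invr_ge0 ltW.
have kK' : 8 * v / eta ^+ 2 <= k%:R * e' ^+ 2 by rewrite kE'.
apply: (@le_trans _ _ (P (D `&` [set t | (e' * k%:R <= S t)%R]))); last first.
  have mDt x : measurable (D `&` tail x) by exact: measurableI.
  apply: le_measure; rewrite ?inE; [exact: mDt|exact: mDt|].
  by apply: setIS => t /=; apply: le_trans; rewrite ler_wpM2r.
apply: le_trans (chernoff_lower eta01 kE e'0 eth' kK').
have -> : k%:R * (e' ^+ 2 / (2 * v)) = 4 / eta ^+ 2.
  by rewrite mulrA kE' /K; field; rewrite !gt_eqF.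
rewrite lee_fin.
set c := expR (- ((1 + 8 * eta) * (4 / _))).
have F1 : expR (- ((1 + 8 * eta) * (k%:R * (eps ^+ 2 / (2 * v))))) <= 1.
  by rewrite x1// mulr_ge0// mulr_ge0// divr_ge0 ?sqr_ge0// mulr_ge0// ltW.
have pc : 0 <= pd * c by rewrite mulr_ge0 ?expR_ge0.
by have := ler_wpM2l pc F1; lra.
Qed.

End chernoff.

(** * Comparison of the deviation probability with iterates of [f] *)

Section deviations.
Context {R : realType} {d : measure_display} {T : measurableType d}.
Variables (P : probability T R) (p : nat -> R) (mu : nat).
Variables (xi : nat -> nat -> T -> nat) (X : nat -> T -> R).
Hypotheses (p_ge0 : forall k, 0 <= p k) (p_sum : series p @ \oo --> (1 : R)).
Hypotheses (p0 : p 0%N = 0) (p1 : p 1%N = 0).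
Hypotheses (p_mu : 0 < p mu) (p_lt_mu : forall k, (k < mu)%N -> p k = 0).
Hypothesis mxi : forall n i, measurable_fun setT (fun t => (xi n i t)%:R : R).
Hypothesis xip : forall n i k, P [set t | xi n i t = k] = (p k)%:E.
Hypothesis mX : forall i, measurable_fun setT (X i).
Hypothesis X_id : forall i A, measurable A -> P (X i @^-1` A) = P (X 0%N @^-1` A).
Hypothesis iY : mutually_independent P
    (fun j : (nat * nat) + nat =>
       match j with inl (n, i) => fun t => (xi n i t)%:R | inr i => X i end).
Notation Z := (GW xi).
Notation v := (variance0 P (X 0%N)).

Lemma integral_identically_distributed i (g : R -> R) : measurable_fun setT g ->
  (forall x, 0 <= g x) -> (\int[P]_t (g (X i t))%:E = \int[P]_t (g (X 0%N t))%:E)%E.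
Proof.
move=> mg g0; rewrite -[RHS]mul1e.
rewrite -(@integral_law_ext _ _ _ P setT (cst 1) (X i) (X 0%N) 1)//.
  by apply: eq_integral => t _; rewrite mul1r.
move=> A mA; rewrite setTI (eq_integral (cst 1%:E))// integral_cst//.
  by rewrite !mul1e; exact: X_id.
exact: measurable_preimage.
Qed.

(** The event [Z n = k] depends only on offspring variables, so it is independent of all the [X i],
    and the exponential of the sum factorises. *)
Lemma integral_GW_expR_Ssum n k (th M : R) :
  (\int[P]_t (expR (th * X 0%N t))%:E = M%:E)%E ->
  (\int[P]_(t in Z n @^-1` [set k]) (expR (th * Ssum X k t))%:E =
   P (Z n @^-1` [set k]) * (M ^+ k)%:E)%E.
Proof.
move=> ME.
pose Y (j : (nat * nat) + nat) : T -> R :=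
  match j with inl (n, i) => fun t => (xi n i t)%:R | inr i => X i end.
have mY j : measurable_fun setT (Y j).
  by case: j => [[n' i]|i]; [exact: mxi|exact: mX].
pose G (j : (nat * nat) + nat) : R -> R :=
  if j is inr _ then (fun x => expR (th * x)) else cst 1.
pose E (j : (nat * nat) + nat) : R := if j is inr _ then M else 1.
have mth : measurable_fun setT (fun x : R => expR (th * x)).
  by apply: measurableT_comp => //; exact: measurable_funM.
have GE j : (\int[P]_t (G j (Y j t))%:E = (E j)%:E)%E.
  case: j => [[n' i]|i].
    by rewrite (eq_integral (cst 1%:E))// integral_cst// mul1e; exact: probability_setT.
  rewrite -ME; apply: (integral_identically_distributed i mth) => x; exact: expR_ge0.
have mG j : measurable_fun setT (G j) by case: j => [[n' i]|i].
have G0 j x : 0 <= G j x by case: j => [[n' i]|i] //=; exact: expR_ge0.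
pose s : seq ((nat * nat) + nat) := [seq inr i | i <- iota 0 k].
have prods (f : (nat * nat) + nat -> R) :
    \prod_(j <- s) f j = \prod_(i < k) f (inr (val i)).
  by rewrite big_map -[in LHS](subn0 k) big_mkord.
have us : uniq s by rewrite map_inj_uniq ?iota_uniq// => i j [].
have Qs : all (unused n 0) s by rewrite all_map; apply/allP.
have iZ : indep_event P Y (unused n 0) (Z n @^-1` [set k]).
  by apply: (indep_hist_saturated mxi mX iY) => t t' /histP /= ->.
have := integral_indep_prod mY mG G0 GE us Qs iZ.
rewrite [X in (_ = _ * X%:E)%E -> _]prods /= prodr_const card_ord => <-.
by apply: eq_integral => t _; rewrite prods /= -expR_sum -mulr_sumr.
Qed.

Lemma measurable_Ssum k : measurable_fun setT (Ssum X k).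
Proof. exact: measurable_sum. Qed.

Let measurable_tail k x : measurable [set t | x <= Ssum X k t].
Proof.
rewrite (_ : [set t | _] = Ssum X k @^-1` `[x, +oo[%classic).
  by apply: measurable_preimage => //; exact: measurable_Ssum.
by apply/seteqP; split => t /=; rewrite in_itv /= andbT.
Qed.

Let dev n (x : R) := [set t | (0 < Z n t)%N /\ x <= Rn xi X n t].

Let dev_fiber n x k : (0 < k)%N ->
  dev n x `&` Z n @^-1` [set k] = Z n @^-1` [set k] `&` [set t | x * k%:R <= Ssum X k t].
Proof.
move=> k0; rewrite /dev /Rn; apply/seteqP; split => t /=.
  by move=> [[_ +] Zk]; rewrite Zk ler_pdivlMr ?ltr0n.
by move=> [Zk +]; rewrite Zk ler_pdivlMr ?ltr0n// => xS; rewrite k0.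
Qed.

Let dev_fiber0 n x : dev n x `&` Z n @^-1` [set 0%N] = set0.
Proof. by apply/seteqP; split => // t /= [[Z0 _] Zk]; rewrite Zk in Z0. Qed.

Let mZ n k : measurable (Z n @^-1` [set k]).
Proof. exact: (measurable_GW mxi mX iY). Qed.

Let mdev_fiber n x k : measurable (dev n x `&` Z n @^-1` [set k]).
Proof.
case: k => [|k]; first by rewrite dev_fiber0.
by rewrite dev_fiber//; exact: measurableI.
Qed.

Let mdev n x : measurable (dev n x).
Proof.
rewrite (_ : dev n x = \bigcup_k (dev n x `&` Z n @^-1` [set k])).
  exact: bigcupT_measurable.
by apply/seteqP; split => [t dt|t [k _ []]//]; exists (Z n t).
Qed.

Let probRnE n x : (\int[P]_t (\1_(dev n x) t)%:E = (probRn P xi X n x)%:E)%E.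
Proof.
rewrite integral_indic// setIT /probRn fineK//.
exact: (fin_num_measure _ _ (mdev n x)).
Qed.

Let m1dev n x : measurable_fun setT (fun t => (\1_(dev n x) t : R)%:E).
Proof. by apply/measurable_EFinP; exact/measurable_indicP. Qed.

Let mpow n (s : R) : measurable_fun setT (fun t => (s ^+ Z n t)%:E).
Proof.
by apply/measurable_EFinP; exact: (measurable_fun_GW mxi mX iY n (fun z => s ^+ z)).
Qed.

Let integral_fiber_pow n k (s : R) :
  (\int[P]_(t in Z n @^-1` [set k]) (s ^+ Z n t)%:E = (s ^+ k)%:E * P (Z n @^-1` [set k]))%E.
Proof.
rewrite -integral_cst//; apply: eq_integral => t; rewrite inE /= => ->//.
Qed.

Let integral_fiber_dev n k x :
  (\int[P]_(t in Z n @^-1` [set k]) (\1_(dev n x) t)%:E = P (dev n x `&` Z n @^-1` [set k]))%E.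
Proof. by rewrite integral_indic. Qed.

(* From [P(Z_n = k) s^k <= f_n(s) <= s^(mu^n)] as [s] tends to [0]. *)
Lemma GW_small_null n k : (k < mu ^ n)%N -> P (Z n @^-1` [set k]) = 0%E.
Proof.
move=> kn; have Pfin : P (Z n @^-1` [set k]) \is a fin_num by exact: fin_num_measure.
suff le_s (s : R) : 0 < s <= 1 -> fine (P (Z n @^-1` [set k])) <= s.
  rewrite -(fineK Pfin); congr EFin; apply/eqP; rewrite eq_le fine_ge0// andbT.
  apply/ler_addgt0Pl => e e0; rewrite addr0.
  have [e1|e1] := leP e 1; first by rewrite le_s// e0.
  by rewrite (le_trans (le_s 1 _))// ?ltr01 ?lexx// ltW.
move=> s01; have /andP[s0 s1] := s01.
have : ((s ^+ k)%:E * P (Z n @^-1` [set k]) <= (pgf_iter p n s)%:E)%E.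
  rewrite -integral_fiber_pow -(integral_GW_pgf mxi xip mX iY p_ge0 p_sum p_mu p_lt_mu)//.
  apply: ge0_subset_integral => // t _; by rewrite lee_fin exprn_ge0// ltW.
rewrite -(fineK Pfin) -EFinM lee_fin => /le_trans.
move=> /(_ _ (pgf_iter_le_pow p_ge0 p_sum p_mu p_lt_mu n s01)) h.
have : s ^+ k * fine (P (Z n @^-1` [set k])) <= s ^+ k * s.
  by rewrite (le_trans h)// -exprSr ler_wiXn2l// ltW.
by rewrite ler_pM2l ?exprn_gt0.
Qed.

Hypothesis iX : P.-integrable setT (EFin \o X 0%N).
Hypothesis X0 : (\int[P]_t (X 0%N t)%:E = 0)%E.
Hypothesis X2 : (0 < \int[P]_t ((X 0%N t) ^+ 2)%:E < +oo)%E.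
Hypothesis Xh : exists h : R, 0 < h /\ (\int[P]_t (expR (h * `|X 0%N t|))%:E < +oo)%E.

Let mgfZ n k kappa th0 : (forall th, `|th| <= th0 -> exists M,
    (\int[P]_t (expR (th * X 0%N t))%:E = M%:E)%E /\
    expR ((1 - kappa) * (v * th ^+ 2 / 2)) <= M <= expR ((1 + kappa) * (v * th ^+ 2 / 2))) ->
  forall th, `|th| <= th0 -> exists M,
    (\int[P]_(t in Z n @^-1` [set k]) (expR (th * Ssum X k t))%:E =
      (fine (P (Z n @^-1` [set k])) * M ^+ k)%:E)%E /\
    expR ((1 - kappa) * (v * th ^+ 2 / 2)) <= M <= expR ((1 + kappa) * (v * th ^+ 2 / 2)).
Proof.
move=> mgf th /mgf[M [ME MP]]; exists M; split => //.
rewrite (integral_GW_expR_Ssum _ _ ME) EFinM fineK//; exact: fin_num_measure.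
Qed.

(** The Chernoff exponent is linear in [k]: on each fibre the bound is [s^k] with the same [s], and
    summing over [k] reassembles [f_n(s)]. *)
Lemma probRn_le (delta : R) : 0 < delta < 1 -> exists2 e0, 0 < e0 &
  forall n x, 0 < x <= e0 ->
  probRn P xi X n x <= pgf_iter p n (expR (- ((1 - delta) * (x ^+ 2 / (2 * v))))).
Proof.
move=> d01; have /andP[d0 d1] := d01; have [h [h0 hP]] := Xh.
have v0 : 0 < v by exact: variance0_gt0.
have [th0 [th00 mgf]] := mgf_bounds (mX 0%N) iX X0 X2 h0 hP d01.
exists (th0 * v); first exact: mulr_gt0.
move=> n x /andP[x0 xe].
have b0 : 0 <= (1 - delta) * (x ^+ 2 / (2 * v)).
  by rewrite mulr_ge0 ?subr_ge0 ?(ltW d1)// divr_ge0 ?sqr_ge0// mulr_ge0// ltW.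
rewrite -lee_fin -probRnE -(integral_GW_pgf mxi xip mX iY p_ge0 p_sum p_mu p_lt_mu); last first.
  by rewrite expR_gt0 expR_le1 oppr_le0.
apply: (le_integral_fibers (mZ n)).
- exact: m1dev.
- exact: mpow.
- by move=> t; rewrite lee_fin.
- by move=> t; rewrite lee_fin exprn_ge0// expR_ge0.
move=> k; rewrite integral_fiber_dev integral_fiber_pow.
have [->|k0] := posnP k.
  by rewrite dev_fiber0 measure0 mule_ge0// lee_fin exprn_ge0// expR_ge0.
have PZfin : P (Z n @^-1` [set k]) \is a fin_num by exact: fin_num_measure.
rewrite dev_fiber//.
have xth : x / v <= th0 by rewrite ler_pdivrMr.
have := chernoff_upper (mZ n k) (measurable_Ssum k) (esym (fineK PZfin)) v0 (mgfZ n k mgf) x0 xth.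
move=> /le_trans; apply; rewrite EFinM fineK// muleC -expRM_natl.
rewrite lee_wpmul2r//lee_fin ler_expR le_eqVlt; apply/orP; left; apply/eqP; ring.
Qed.

(** The lower Chernoff bound needs [k >= K]. By [GW_small_null] the fibres with [k < mu^n] are null,
    and [mu^n > n] makes the others large enough once [n >= n0]. *)
Lemma probRn_ge (delta : R) : 0 < delta < 1 -> exists e0 c n0, [/\ 0 < e0, 0 < c &
  forall n x, (n0 <= n)%N -> 0 < x <= e0 ->
  c * pgf_iter p n (expR (- ((1 + delta) * (x ^+ 2 / (2 * v))))) <= probRn P xi X n x].
Proof.
move=> /andP[d0 d1]; have [h [h0 hP]] := Xh.
have v0 : 0 < v by exact: variance0_gt0.
pose eta := delta / 8; have dE : delta = 8 * eta by rewrite /eta; field.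
have eta01 : 0 < eta <= 1 by rewrite /eta; apply/andP; split; lra.
have /andP[eta0 eta1] := eta01.
pose kappa := eta ^+ 2 / 26.
have k01 : 0 < kappa < 1.
  by rewrite /kappa divr_gt0 ?exprn_gt0//=; nra.
have [th0 [th00 mgf]] := mgf_bounds (mX 0%N) iX X0 X2 h0 hP k01.
pose K := 8 * v / eta ^+ 2 / (th0 * v / (1 + 2 * eta)) ^+ 2.
have eta20 : 0 < 1 + 2 * eta by lra.
exists (th0 * v / (1 + 2 * eta)), (expR (- ((1 + 8 * eta) * (4 / eta ^+ 2))) / 2).
exists (Num.bound K); split; [by rewrite divr_gt0// mulr_gt0|by rewrite divr_gt0// expR_gt0|].
set c := expR _ / 2; have c0 : 0 < c by rewrite divr_gt0// expR_gt0.
move=> n x nK /andP[x0 xe]; rewrite dE.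
have b0 : 0 <= (1 + 8 * eta) * (x ^+ 2 / (2 * v)).
  by rewrite mulr_ge0//; [lra|rewrite divr_ge0 ?sqr_ge0// mulr_ge0// ltW].
set s := expR (- _).
have s01 : 0 < s <= 1 by rewrite expR_gt0 expR_le1 oppr_le0.
have s0 : 0 <= s by rewrite expR_ge0.
rewrite -lee_fin -probRnE EFinM -(integral_GW_pgf mxi xip mX iY p_ge0 p_sum p_mu p_lt_mu)//.
rewrite -ge0_integralZl_EFin ?(ltW c0)//; last first.
  by move=> t _; rewrite lee_fin exprn_ge0.
apply: (le_integral_fibers (mZ n)).
- by apply: emeasurable_funM => //.
- exact: m1dev.
- by move=> t; rewrite mule_ge0// lee_fin ?exprn_ge0// ltW.
- by move=> t; rewrite lee_fin.
move=> k; rewrite integral_fiber_dev ge0_integralZl_EFin ?(ltW c0)//; last 2 first.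
- by move=> t _; rewrite lee_fin exprn_ge0.
- exact: measurable_funTS.
rewrite integral_fiber_pow.
have [kn|nk] := ltnP k (mu ^ n); first by rewrite GW_small_null// mule0 mule0.
have mu2 : (1 < mu)%N := mu_ge2 p0 p1 p_mu.
have nk' : (n < k)%N by rewrite (leq_trans _ nk)// ltn_expl.
have k0 : (0 < k)%N by rewrite (leq_ltn_trans _ nk').
have PZfin : P (Z n @^-1` [set k]) \is a fin_num by exact: fin_num_measure.
rewrite dev_fiber//.
have xth : (1 + 2 * eta) * (x / v) <= th0.
  move: xe; rewrite ler_pdivlMr// => xe.
  by rewrite mulrA ler_pdivrMr// [_ * x]mulrC.
have Kk : K <= k%:R.
  rewrite (le_trans (ltW (archi_boundP _)))//.
    by rewrite /K divr_ge0 ?sqr_ge0// divr_ge0 ?sqr_ge0// mulr_ge0// ltW.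
  by rewrite ler_nat (leq_trans nK)// ltnW.
have := chernoff_lower_uniform (mZ n k) (measurable_Ssum k) (esym (fineK PZfin)) v0
  (mgfZ n k mgf) eta01 erefl th00 x0 xth Kk.
apply: le_trans; rewrite -/c [leRHS]EFinM [(fine _ * _)%:E]EFinM fineK// [X in (_ <= _ * X)%E]muleC.
rewrite lee_wpmul2l ?lee_fin ?(ltW c0)// lee_wpmul2r// lee_fin -expRM_natl ler_expR.
by rewrite le_eqVlt; apply/orP; left; apply/eqP; ring.
Qed.

End deviations.

(** * Asymptotics of the deviation probabilities *)

Section asymptotics.
Context {R : realType} {d : measure_display} {T : measurableType d}.
Variables (P : probability T R) (p : nat -> R) (m : R) (mu : nat) (beta : R).
Variables (xi : nat -> nat -> T -> nat) (X : nat -> T -> R) (eps : nat -> R).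
Hypotheses (p_ge0 : forall k, 0 <= p k) (p_sum : series p @ \oo --> (1 : R)).
Hypothesis p_mean : series (fun k => k%:R * p k) @ \oo --> m.
Hypothesis m_gt1 : 1 < m.
Hypotheses (p0 : p 0%N = 0) (p1 : p 1%N = 0).
Hypotheses (p_mu : 0 < p mu) (p_lt_mu : forall k, (k < mu)%N -> p k = 0).
Hypothesis mu_beta : mu%:R = m `^ beta.
Hypothesis mxi : forall n i, measurable_fun setT (fun t => (xi n i t)%:R : R).
Hypothesis xip : forall n i k, P [set t | xi n i t = k] = (p k)%:E.
Hypothesis mX : forall i, measurable_fun setT (X i).
Hypothesis X_id : forall i A, measurable A -> P (X i @^-1` A) = P (X 0%N @^-1` A).
Hypothesis iY : mutually_independent P
    (fun j : (nat * nat) + nat =>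
       match j with inl (n, i) => fun t => (xi n i t)%:R | inr i => X i end).
Hypothesis iX : P.-integrable setT (EFin \o X 0%N).
Hypothesis X0 : (\int[P]_t (X 0%N t)%:E = 0)%E.
Hypothesis X2 : (0 < \int[P]_t ((X 0%N t) ^+ 2)%:E < +oo)%E.
Hypothesis Xh : exists h : R, 0 < h /\ (\int[P]_t (expR (h * `|X 0%N t|))%:E < +oo)%E.
Hypothesis eps_gt0 : forall n, 0 < eps n.
Hypothesis eps0 : eps @ \oo --> (0 : R).
Hypothesis eps_oo : (fun n => eps n ^+ 2 * m ^+ n) @ \oo --> +oo.
Notation v := (variance0 P (X 0%N)).
Notation a := (1 / (2 * v)).
Notation L := (ln (Boettcher p mu (phiW P xi m a))).

Let m_gt0 : 0 < m. Proof. exact: lt_trans m_gt1. Qed.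
Let v_gt0 : 0 < v. Proof. exact: variance0_gt0. Qed.
Let a_ge0 : 0 <= a. Proof. by rewrite divr_ge0// mulr_ge0// ltW. Qed.
Let mu_gt1 : (1 < mu)%N. Proof. exact: (mu_ge2 p0 p1 p_mu). Qed.
Let mu_gt0 : 0 < mu%:R :> R. Proof. by rewrite ltr0n ltnW. Qed.

Lemma beta_gt0 : 0 < beta.
Proof.
rewrite ltNge; apply/negP => b0.
have : m `^ beta <= m `^ 0 by rewrite ler_powR// ltW.
by rewrite powRr0 -mu_beta lern1 leqNgt mu_gt1.
Qed.

Section scale.
Variables (l : nat -> nat) (c1 c2 : R).
Hypothesis c1_gt0 : 0 < c1.
Hypothesis l_scale : \forall n \near \oo, c1 <= eps n ^+ 2 * m ^+ l n <= c2.

Let eps2 K : 0 < K -> \forall n \near \oo, eps n ^+ 2 < K.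
Proof.
move=> K0; have : (fun n => eps n * eps n) @ \oo --> (0 * 0 : R) by exact: cvgM.
rewrite mulr0 => /cvgrPdist_lt/(_ _ K0); apply: filterS => n.
by rewrite sub0r normrN expr2; apply: le_lt_trans; exact: ler_norm.
Qed.

Let l_oo K : \forall n \near \oo, (K <= l n)%N.
Proof.
have cK : 0 < c1 / m ^+ K by rewrite divr_gt0// exprn_gt0.
apply: filterS2 l_scale (eps2 cK) => n /andP[cq _]; rewrite ltr_pdivlMr ?exprn_gt0// => eK.
rewrite leqNgt; apply/negP => lK; move: (lt_le_trans eK cq).
by rewrite ltr_pM2l ?exprn_gt0// ltr_eXn2l// ltnNge (ltnW lK).
Qed.

(** As [eps^2 m^l] stays bounded while [eps^2 m^n -> oo], the number [n - l] of outer iterations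
    tends to infinity. *)
Let n_l_oo K : \forall n \near \oo, (l n + K <= n)%N.
Proof.
have /cvgryPgt/(_ (c2 * m ^+ K)) h := eps_oo.
apply: filterS2 l_scale h => n /andP[_ qc] c2e.
rewrite leqNgt; apply/negP => nlK.
have : eps n ^+ 2 * m ^+ n <= c2 * m ^+ K.
  rewrite (@le_trans _ _ (eps n ^+ 2 * m ^+ l n * m ^+ K))//.
    rewrite -mulrA -exprD ler_wpM2l ?sqr_ge0// ler_weXn2l ?(ltW m_gt1)//.
    exact: ltnW.
  by rewrite ler_wpM2r// exprn_ge0// ltW.
by rewrite leNgt c2e.
Qed.

Let N n := (n - l n)%N.
Let x n := pgf_iter p (l n) (expR (- (a / m ^+ l n))).
Let b n := logpgf p mu (N n) (x n).

Let s01 n : 0 < expR (- (a / m ^+ l n)) <= 1.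
Proof. by rewrite expR_gt0 expR_le1 oppr_le0 divr_ge0// exprn_ge0// ltW. Qed.

Let x01 n : 0 < x n <= 1.
Proof. exact: (pgf_iter_itv p_ge0 p_sum p_mu p_lt_mu). Qed.

Let b_le0 n : b n <= 0.
Proof. exact: (logpgf_le0 p_ge0 p_sum p_mu p_lt_mu). Qed.

Let phi01 := phiW_itv p_ge0 p_sum p_mean m_gt1 p_mu p_lt_mu mxi xip mX iY a_ge0.

Let N_oo K : \forall n \near \oo, (K <= N n)%N.
Proof. by apply: filterS (n_l_oo K) => n lK; rewrite /N leq_subRL ?(leq_trans _ lK)// leq_addr. Qed.

Let cvg_b : b @ \oo --> L.
Proof.
apply: (cvg_logpgf_diag p_ge0 p_sum p_mean p0 p1 p_mu p_lt_mu) => //.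
have := cvg_phiW p_ge0 p_sum p_mean m_gt1 p_mu p_lt_mu mxi xip mX iY a_ge0.
move=> /cvgrPdist_le cphi; apply/cvgrPdist_le => e e0.
have [K _ KP] := cphi e e0.
by apply: filterS (l_oo K) => n Kn; exact: KP.
Qed.

Let pgf_iter_split n : (l n <= n)%N ->
  ln (pgf_iter p n (expR (- (a / m ^+ l n)))) = mu%:R ^+ N n * b n.
Proof.
move=> lnn; rewrite /b /logpgf mulrCA mulfV ?mulr1 ?expf_neq0 ?gt_eqF//.
by rewrite /x /pgf_iter -iterD subnK.
Qed.

(** By [mu = m^beta], the normalisation is [mu^(n-l)] times a correction that depends only on how
    far [eps^2 m^l] is from [1]. *)
Let normlogPE n : (l n <= n)%N -> normlogP P xi X m beta eps n =
  ((eps n ^+ 2 * m ^+ l n) `^ beta)^-1 * (ln (probRn P xi X n (eps n)) / mu%:R ^+ N n).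
Proof.
move=> lnn; rewrite /normlogP mulrA [RHS]mulrAC; congr (_ * _).
rewrite powRM ?sqr_ge0 ?exprn_ge0 ?(ltW m_gt0)// invfM -[RHS]mulrA; congr (_ * _).
  by rewrite powRN powRrM powR_mulrn// ltW.
rewrite -[m ^+ l n]powR_mulrn ?(ltW m_gt0)// mu_beta -[(m `^ beta) ^+ _]powR_mulrn ?powR_ge0//.
rewrite powRN -!powRrM -invfM -powRD; last by rewrite (gt_eqF m_gt0) implybT.
by rewrite [(l n)%:R * beta]mulrC -mulrDr -natrD subnKC.
Qed.

Let near_eps e : 0 < e -> \forall n \near \oo, 0 < eps n <= e.
Proof.
move=> e0; move/cvgrPdist_le : eps0 => /(_ _ e0); apply: filterS => n.
by rewrite sub0r normrN eps_gt0; apply: le_trans; exact: ler_norm.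
Qed.

Let aE n : a * eps n ^+ 2 = eps n ^+ 2 / (2 * v).
Proof. by rewrite div1r mulrC. Qed.

(* Needed because [ln] is [0] at [0]. *)
Let near_probRn_gt0 : \forall n \near \oo, 0 < probRn P xi X n (eps n).
Proof.
have h : 0 < (2^-1 : R) < 1 by apply/andP; split; lra.
have [e0 [c [n0 [e00 c0 cP]]]] :=
  probRn_ge p_ge0 p_sum p0 p1 p_mu p_lt_mu mxi xip mX X_id iY iX X0 X2 Xh h.
near=> n; apply: lt_le_trans (cP n (eps n) _ _).
- rewrite mulr_gt0//; set s := expR _.
  have s01' : 0 < s <= 1.
    by rewrite expR_gt0 expR_le1 oppr_le0 mulr_ge0 ?divr_ge0 ?sqr_ge0 ?mulr_ge0 ?(ltW v_gt0).
  by have /andP[] := pgf_iter_itv p_ge0 p_sum p_mu p_lt_mu n s01'.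
- by near: n; exists n0.
- by near: n; exact: near_eps.
Unshelve. all: by end_near. Qed.

Let e01 n : 0 < expR (- (eps n ^+ 2 / (2 * v))) <= 1.
Proof.
by rewrite expR_gt0 expR_le1 oppr_le0 divr_ge0 ?sqr_ge0// mulr_ge0// ltW.
Qed.

Let pgf_gt0 n s : 0 < s <= 1 -> 0 < pgf_iter p n s.
Proof. by move=> /(pgf_iter_itv p_ge0 p_sum p_mu p_lt_mu n)/andP[]. Qed.

Lemma normlogP_le kappa e : 1 <= kappa -> 0 < e ->
  (\forall n \near \oo, 1 <= eps n ^+ 2 * m ^+ l n /\
     (eps n ^+ 2 * m ^+ l n) `^ beta <= kappa) ->
  \forall n \near \oo, normlogP P xi X m beta eps n <= kappa^-1 * L + e.
Proof.
move=> k1 e0 qP; have k0 : 0 < kappa by exact: lt_le_trans k1.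
have ki1 : kappa^-1 <= 1 by rewrite invf_le1.
have ki0 : 0 < kappa^-1 by rewrite invr_gt0.
(* Makes [delta |L| <= e / 2]; the [+ 1] covers [L = 0]. *)
pose delta := Num.min 2^-1 (e / (2 * (`|L| + 1))).
have L1 : 0 < `|L| + 1 by rewrite ltr_wpDl.
have d0 : 0 < delta by rewrite lt_min invr_gt0 ltr0n divr_gt0// mulr_gt0.
have d1 : delta < 1 by rewrite gt_min; apply/orP; left; lra.
have dL : delta * `|L| <= e / 2.
  have : delta <= e / (2 * (`|L| + 1)) by rewrite ge_min lexx orbT.
  rewrite ler_pdivlMr ?mulr_gt0// => h; have := normr_ge0 L; nra.
have [e1 e10 e1P] := probRn_le p_ge0 p_sum p_mu p_lt_mu mxi xip mX X_id iY iX X0 X2 Xh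
  (introT andP (conj d0 d1)).
have e20 : 0 < e / 2 by rewrite divr_gt0.
near=> n.
have lnn : (l n <= n)%N by rewrite -[l n]addn0; near: n; exact: n_l_oo.
have [q1 Qk] : 1 <= eps n ^+ 2 * m ^+ l n /\ (eps n ^+ 2 * m ^+ l n) `^ beta <= kappa.
  by near: n.
have P0 : 0 < probRn P xi X n (eps n) by near: n.
have bL : b n <= L + e / 2.
  have : `|L - b n| <= e / 2 by near: n; move/cvgrPdist_le : cvg_b; exact.
  by rewrite ler_norml => /andP[]; lra.
have lnP : ln (probRn P xi X n (eps n)) <= (1 - delta) * (mu%:R ^+ N n * b n).
  have d10 : 0 < 1 - delta by rewrite subr_gt0.
  have : probRn P xi X n (eps n) <=
      pgf_iter p n (expR (- ((1 - delta) * (eps n ^+ 2 / (2 * v))))).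
    by apply: e1P; near: n; exact: near_eps.
  set y := - _; have y0 : y <= 0.
    rewrite oppr_le0 mulr_ge0 ?(ltW d10)// divr_ge0 ?sqr_ge0// mulr_ge0// ltW//.
  have ey01 : 0 < expR y <= 1 by rewrite expR_gt0 expR_le1.
  rewrite -ler_ln ?posrE ?pgf_gt0// => /le_trans; apply.
  (* The scaling inequality needs a factor at least [1], so it is applied from [(1 - delta) a eps^2]
     up to [a eps^2]. *)
  have d11 : 1 <= (1 - delta)^-1 by rewrite -invr1 lef_pV2 ?posrE//; lra.
  have := ln_pgf_iter_scale p_ge0 p_sum p_mu p_lt_mu n d11 y0.
  rewrite mulrC ler_pdivrMr// mulrC => /le_trans; apply.
  rewrite ler_wpM2l ?(ltW d10)// -pgf_iter_split//.
  have -> : (1 - delta)^-1 * y = - (eps n ^+ 2 / (2 * v)).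
    by rewrite /y mulrN mulKf// gt_eqF.
  rewrite ler_ln ?posrE ?pgf_gt0//.
  apply: (pgf_iter_le p_ge0 p_sum p_mu p_lt_mu); rewrite ?expR_gt0//; last first.
    by case/andP: (s01 n).
  rewrite ler_expR lerN2 -aE ler_wpM2l// -[leLHS]mul1r ler_pdivrMr ?exprn_gt0//.
rewrite normlogPE//.
set Q := _ `^ beta in Qk *.
have Q0 : 0 < Q by rewrite powR_gt0// (lt_le_trans _ q1).
have muN : 0 < mu%:R ^+ N n :> R by rewrite exprn_gt0.
have lnPb : ln (probRn P xi X n (eps n)) / mu%:R ^+ N n <= (1 - delta) * b n.
  by rewrite ler_pdivrMr// -mulrA [b n * _]mulrC.
have db0 : (1 - delta) * b n <= 0 by rewrite mulr_ge0_le0// subr_ge0 ltW.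
have Qi : kappa^-1 <= Q^-1 by rewrite lef_pV2 ?posrE.
apply: (@le_trans _ _ (kappa^-1 * ((1 - delta) * b n))).
  apply: (@le_trans _ _ (Q^-1 * ((1 - delta) * b n))).
    by rewrite ler_wpM2l// invr_ge0 ltW.
  by rewrite ler_wnM2r.
have dbL : (1 - delta) * b n <= L + e.
  have := ler_norm (- L); rewrite normrN => h.
  have := ler_wpM2l (ltW d0) h; have : (1 - delta) * b n <= (1 - delta) * (L + e / 2).
    by rewrite ler_wpM2l// subr_ge0 ltW.
  nra.
have := ler_wpM2l (ltW ki0) dbL; nra.
Unshelve. all: by end_near. Qed.

Lemma normlogP_ge kappa e : 1 <= kappa -> 0 < e ->
  (\forall n \near \oo, eps n ^+ 2 * m ^+ l n <= 1 /\
     kappa^-1 <= (eps n ^+ 2 * m ^+ l n) `^ beta) ->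
  \forall n \near \oo, kappa * L - e <= normlogP P xi X m beta eps n.
Proof.
move=> k1 e0 qP; have k0 : 0 < kappa by exact: lt_le_trans k1.
(* Four losses of size [f]: the constant [c], the distance from [b n] to [L], and [delta] times
   [|L|] and times [f]. *)
pose f := e / (4 * kappa).
have f0 : 0 < f by rewrite divr_gt0// mulr_gt0.
have L1 : 0 < `|L| + 1 by rewrite ltr_wpDl.
pose delta := Num.min 2^-1 (f / (`|L| + 1)).
have d0 : 0 < delta by rewrite lt_min invr_gt0 ltr0n divr_gt0.
have d1 : delta < 1 by rewrite gt_min; apply/orP; left; lra.
have dL : delta * `|L| <= f.
  have : delta <= f / (`|L| + 1) by rewrite ge_min lexx orbT.
  rewrite ler_pdivlMr// => h; nra.
have [e1 [c [n0 [e10 c0 cP]]]] := probRn_ge p_ge0 p_sum p0 p1 p_mu p_lt_mu mxi xip mX X_id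
  iY iX X0 X2 Xh (introT andP (conj d0 d1)).
have cvgc : (fun n => `|ln c| / mu%:R ^+ N n) @ \oo --> (0 : R).
  have : (fun n => `|ln c| * mu%:R^-1 ^+ n) @ \oo --> (0 : R).
    rewrite -[X in _ --> X](mulr0 `|ln c|); apply: cvgMl_tmp; apply: cvg_expr.
    by rewrite ger0_norm ?invr_ge0 ?ltW// invf_lt1// ltr1n.
  move=> /cvgrPdist_le h; apply/cvgrPdist_le => g g0; have [K _ KP] := h g g0.
  by apply: filterS (N_oo K) => n Kn; have := KP _ Kn; rewrite exprVn.
near=> n.
have lnn : (l n <= n)%N by rewrite -[l n]addn0; near: n; exact: n_l_oo.
have [q1 Qk] : eps n ^+ 2 * m ^+ l n <= 1 /\ kappa^-1 <= (eps n ^+ 2 * m ^+ l n) `^ beta.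
  by near: n.
have P0 : 0 < probRn P xi X n (eps n) by near: n.
have bL : L - f <= b n.
  have : `|L - b n| <= f by near: n; move/cvgrPdist_le : cvg_b; exact.
  by rewrite ler_norml => /andP[]; lra.
have cf : `|ln c| / mu%:R ^+ N n <= f.
  have : `|0 - `|ln c| / mu%:R ^+ N n| <= f by near: n; move/cvgrPdist_le : cvgc; exact.
  by rewrite sub0r normrN; apply: le_trans; exact: ler_norm.
have lnP : - `|ln c| + (1 + delta) * (mu%:R ^+ N n * b n) <= ln (probRn P xi X n (eps n)).
  have d10 : 1 <= 1 + delta by lra.
  have : c * pgf_iter p n (expR (- ((1 + delta) * (eps n ^+ 2 / (2 * v))))) <=
      probRn P xi X n (eps n).
    by apply: cP; near: n; [exists n0|exact: near_eps].
  have /andP[_] := e01 n; rewrite expR_le1 => y0.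
  rewrite -mulrN.
  have ey01 : 0 < expR ((1 + delta) * - (eps n ^+ 2 / (2 * v))) <= 1.
    by rewrite expR_gt0 expR_le1 mulr_ge0_le0// (le_trans ler01).
  have g0 := pgf_gt0 n ey01.
  rewrite -ler_ln ?posrE ?mulr_gt0// lnM ?posrE//; apply: le_trans.
  rewrite lerD//; first by rewrite lerNl (le_trans (ler_norm _))// normrN.
  apply: le_trans (ln_pgf_iter_scale p_ge0 p_sum p_mu p_lt_mu n d10 y0).
  rewrite ler_wpM2l ?(le_trans ler01)// -pgf_iter_split//.
  rewrite ler_ln ?posrE ?pgf_gt0//.
  apply: (pgf_iter_le p_ge0 p_sum p_mu p_lt_mu); rewrite ?expR_gt0//; last first.
    by rewrite expR_le1.
  rewrite ler_expR lerN2 -aE ler_wpM2l// -[leRHS]mul1r ler_pdivlMr ?exprn_gt0//.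
rewrite normlogPE//.
set Q := _ `^ beta in Qk *.
have Q0 : 0 < Q by rewrite (lt_le_trans _ Qk)// invr_gt0.
have muN : 0 < mu%:R ^+ N n :> R by rewrite exprn_gt0.
pose B := - (`|ln c| / mu%:R ^+ N n) + (1 + delta) * b n.
have lnPb : B <= ln (probRn P xi X n (eps n)) / mu%:R ^+ N n.
  rewrite ler_pdivlMr// /B mulrDl mulNr divfK ?gt_eqF// -mulrA [b n * _]mulrC//.
have B0 : B <= 0.
  rewrite /B; have : 0 <= `|ln c| / mu%:R ^+ N n by rewrite divr_ge0// ltW.
  have := b_le0 n; nra.
have Qi : Q^-1 <= kappa by rewrite -[leRHS]invrK lef_pV2 ?posrE ?invr_gt0.
apply: (@le_trans _ _ (kappa * B)).
  have BL : L - 4 * f <= B.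
    rewrite /B; have := ler_norm (- L); rewrite normrN => h.
    have := ler_wpM2l (ltW d0) h; have := ler_wpM2l (ltW d0) bL; nra.
  have := ler_wpM2l (ltW k0) BL; rewrite mulrBr.
  by rewrite (_ : kappa * (4 * f) = e)// /f; field; rewrite gt_eqF.
apply: (@le_trans _ _ (Q^-1 * B)); first by rewrite ler_wnM2r.
by rewrite ler_wpM2l// invr_ge0 ltW.
Unshelve. all: by end_near. Qed.

End scale.

End asymptotics.

Lemma exists_scale {R : realType} (m x : R) : 1 < m -> 0 < x < 1 ->
  exists l : nat, x * m ^+ l <= 1 <= x * m ^+ l.+1.
Proof.
move=> m1 /andP[x0 x1]; have m0 : 0 < m by exact: lt_trans m1.
have ex : exists k, 1 <= x * m ^+ k.
  have : (fun k => m^-1 ^+ k) @ \oo --> (0 : R).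
    by apply: cvg_expr; rewrite ger0_norm ?invr_ge0 ?ltW// invf_lt1.
  move=> /cvgrPdist_le/(_ _ x0) [k _ /(_ k (leqnn k))].
  rewrite sub0r normrN exprVn ger0_norm ?invr_ge0 ?exprn_ge0 ?(ltW m0)// => mk.
  by exists k; rewrite -ler_pdivrMr ?exprn_gt0// mul1r.
case: (ex_minnP ex) => -[|l] xl lmin; first by move: xl; rewrite expr0 mulr1 leNgt x1.
exists l; rewrite xl andbT leNgt; apply/negP => /ltW /lmin.
by rewrite ltnn.
Qed.

Theorem theorem3 (R : realType) (d : measure_display) (T : measurableType d)
  (P : probability T R) (p : nat -> R) (m : R) (mu : nat) (beta : R)
  (xi : nat -> nat -> T -> nat) (X : nat -> T -> R) (eps : nat -> R) :
  (* offspring law {p_k} with mean m in (1, oo) and E Z_1 log Z_1 < oo *)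
  (forall k, 0 <= p k) ->
  series p @ \oo --> (1 : R) ->
  series (fun k => k%:R * p k) @ \oo --> m ->
  1 < m ->
  cvgn (series (fun k => k%:R * ln k%:R * p k)) ->
  (* Boettcher case *)
  p 0%N = 0 -> p 1%N = 0 ->
  (* mu = min {k : p_k > 0} and mu = m^beta *)
  0 < p mu -> (forall k, (k < mu)%N -> p k = 0) ->
  mu%:R = m `^ beta ->
  (* offspring variables i.i.d. with law p *)
  (forall n i, measurable_fun setT (fun t => (xi n i t)%:R : R)) ->
  (forall n i k, P [set t | xi n i t = k] = (p k)%:E) ->
  (* X_i identically distributed *)
  (forall i, measurable_fun setT (X i)) ->
  (forall i A, measurable A -> P (X i @^-1` A) = P (X 0%N @^-1` A)) ->
  (* all offspring variables and all X_i mutually independent *)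
  mutually_independent P
    (fun j : (nat * nat) + nat =>
       match j with inl (n, i) => fun t => (xi n i t)%:R | inr i => X i end) ->
  (* E X = 0, sigma^2 = E X^2 in (0, oo), exponential moment *)
  P.-integrable setT (EFin \o X 0%N) ->
  (\int[P]_t (X 0%N t)%:E = 0)%E ->
  (0 < \int[P]_t ((X 0%N t) ^+ 2)%:E < +oo)%E ->
  (exists h : R, 0 < h /\ (\int[P]_t (expR (h * `|X 0%N t|))%:E < +oo)%E) ->
  (* the deviation sequence *)
  (forall n, 0 < eps n) ->
  eps @ \oo --> (0 : R) ->
  (fun n => eps n ^+ 2 * m ^+ n) @ \oo --> +oo ->
  let L := ln (Boettcher p mu (phiW P xi m (1 / (2 * variance0 P (X 0%N))))) in
  ((mu%:R * L)%:E <= limn_einf (fun n => (normlogP P xi X m beta eps n)%:E))%E /\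
  (limn_einf (fun n => (normlogP P xi X m beta eps n)%:E) <=
   limn_esup (fun n => (normlogP P xi X m beta eps n)%:E))%E /\
  (limn_esup (fun n => (normlogP P xi X m beta eps n)%:E) <= ((mu%:R)^-1 * L)%:E)%E /\
  (forall lam : nat -> int,
     (fun n => (lam n)%:~R : R) @ \oo --> +oo ->
     (fun n => (lam n)%:~R / n%:R : R) @ \oo --> (0 : R) ->
     (forall n, eps n = m `^ (- ((lam n)%:~R / 2))) ->
     normlogP P xi X m beta eps @ \oo --> L).
Proof.
move=> p_ge0 p_sum p_mean m_gt1 _ p0 p1 p_mu p_lt_mu mu_beta mxi xip mX X_id iY iX X0 X2 Xh
  eps_gt0 eps0 eps_oo L.
have m_gt0 : 0 < m by exact: lt_trans m_gt1.
have beta0 : 0 < beta := beta_gt0 m_gt1 p0 p1 p_mu mu_beta.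
have mu1 : 1 <= mu%:R :> R by rewrite ler1n ltnW// (mu_ge2 p0 p1 p_mu).
have upper := normlogP_le p_ge0 p_sum p_mean m_gt1 p0 p1 p_mu p_lt_mu mu_beta mxi xip mX X_id
  iY iX X0 X2 Xh eps_gt0 eps0 eps_oo.
have lower := normlogP_ge p_ge0 p_sum p_mean m_gt1 p0 p1 p_mu p_lt_mu mu_beta mxi xip mX X_id
  iY iX X0 X2 Xh eps_gt0 eps0 eps_oo.
have eps2_lt1 : \forall n \near \oo, eps n ^+ 2 < 1.
  move/cvgrPdist_lt : eps0 => /(_ _ ltr01); apply: filterS => n.
  rewrite sub0r normrN => /(le_lt_trans (ler_norm _)) e1.
  by rewrite exprn_ilt1// ltW.
have [l lP] : exists l : nat -> nat, forall n, eps n ^+ 2 < 1 ->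
    eps n ^+ 2 * m ^+ l n <= 1 <= eps n ^+ 2 * m ^+ (l n).+1.
  suff /choice[l lP] : forall n, exists l : nat, eps n ^+ 2 < 1 ->
      eps n ^+ 2 * m ^+ l <= 1 <= eps n ^+ 2 * m ^+ l.+1 by exists l.
  move=> n; have [e1|e1] := ltP (eps n ^+ 2) 1; last by exists 0%N.
  have [|k kP] := @exists_scale _ m (eps n ^+ 2) m_gt1; last by exists k.
  by rewrite e1 exprn_gt0.
split; [|split; [exact: limn_einf_sup|split]].
- apply/lee_addgt0Pr => e e0; rewrite -leeBlDr// -EFinB.
  apply: (@limn_einf_ge _ (normlogP P xi X m beta eps)).
  (* Rounding [l] down puts [eps^2 m^l] in [[1/m, 1]], whose [beta]-th power is at least [1 / mu].
     Logarithms being nonpositive, this gives the lower bound with factor [mu]. *)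
  have sc : \forall n \near \oo, m^-1 <= eps n ^+ 2 * m ^+ l n <= 1.
    apply: filterS eps2_lt1 => n /lP/andP[-> h]; rewrite andbT.
    by rewrite -[m^-1]mul1r ler_pdivrMr// -mulrA -exprSr.
  apply: (lower _ _ _ _ sc _ _ mu1 e0); first by rewrite invr_gt0.
  apply: filterS sc => n /andP[q1 q2]; split => //.
  have -> : mu%:R^-1 = m^-1 `^ beta.
    by rewrite mu_beta -[m^-1]powR_inv1 ?(ltW m_gt0)// -powRrM mulN1r powRN.
  have m0 : 0 <= m^-1 by rewrite invr_ge0 ltW.
  by rewrite ge0_ler_powR ?nnegrE ?(ltW beta0)// (le_trans m0).
- apply/lee_addgt0Pr => e e0; rewrite -EFinD.
  apply: (@limn_esup_le _ (normlogP P xi X m beta eps)).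
  (* Rounding up instead puts the product in [[1, m]] and gives the upper bound. *)
  have sc : \forall n \near \oo, 1 <= eps n ^+ 2 * m ^+ (l n).+1 <= m.
    apply: filterS eps2_lt1 => n /lP/andP[h ->] /=.
    by rewrite [m ^+ _]exprSr mulrA ler_piMl// ltW.
  apply: (upper (fun n => (l n).+1) _ _ ltr01 sc _ _ mu1 e0).
  apply: filterS sc => n /andP[q1 q2]; split => //.
  rewrite mu_beta ge0_ler_powR ?nnegrE ?(ltW beta0)// ?(ltW m_gt0)//.
  by rewrite (le_trans ler01).
- move=> lam lam_oo _ epsE; pose k n := absz (lam n).
  (* Here [l = lam n] hits the scale exactly, so both bounds hold with factor [1]. Since [lam n] is
     an integer, its absolute value serves as exponent once it is nonnegative. *)
  have sc : \forall n \near \oo, eps n ^+ 2 * m ^+ k n = 1.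
    move/cvgryPge : lam_oo => /(_ 0); apply: filterS => n lam0.
    have lamE : (lam n)%:~R = (k n)%:R :> R.
      by rewrite /k natr_absz ger0_norm// -(ler0z R).
    rewrite epsE -powR_mulrn ?powR_ge0// -[m ^+ _]powR_mulrn ?(ltW m_gt0)// -powRrM lamE.
    rewrite -powRD; last by rewrite (gt_eqF m_gt0) implybT.
    by rewrite mulNr divfK// addNr powRr0.
  have sc1 : \forall n \near \oo, 1 <= eps n ^+ 2 * m ^+ k n <= 1.
    by apply: filterS sc => n ->; rewrite lexx.
  apply/cvgrPdist_le => e e0.
  have up : \forall n \near \oo, normlogP P xi X m beta eps n <= 1^-1 * L + e.
    apply: (upper _ _ _ ltr01 sc1 _ _ (lexx _) e0).
    by apply: filterS sc => n ->; rewrite powR1 lexx.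
  have lo : \forall n \near \oo, 1 * L - e <= normlogP P xi X m beta eps n.
    apply: (lower _ _ _ ltr01 sc1 _ _ (lexx _) e0).
    by apply: filterS sc => n ->; rewrite powR1 invr1 lexx.
  clearbody L; rewrite invr1 mul1r in up; rewrite mul1r in lo.
  apply: filterS2 up lo => n h1 h2.
  by rewrite ler_norml; apply/andP; split; lra.
Qed.
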